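(* Fix $\sigma>0$ and a continuous $a:[0,1]\to\mathbb{R}$. There exists $H_c\in(\tfrac12,1)$ such that for every $H\in(H_c,1)$, $$P(|\mathcal{Y}^H_n|>g_n^H\ \text{i.o.})=1,$$ and for every $H\in(\tfrac12,H_c)$, $$P(|\mathcal{Y}^H_n|>g_n^H\ \text{ult.})=0.$$ In particular, if $H\in(H_c,1)$ then $\lim_{N\to\infty}\frac{|\mathcal{A}_\mathcal{P}^{(N,H)}|}{2^{N-1}}=1$.
   Context: For $H\in(\frac12,1)$ let $c_H=\sqrt{\frac{2H\,\Gamma(\frac32-H)}{\Gamma(H+\frac12)\Gamma(2-2H)}}$ and $C_H=c_H(H-\frac12)$. For integers $1\le i<n$ let $j_n^H(i)=\sigma C_H\int_{i-1}^i x^{\frac12-H}\Big(\int_0^1(v+n-1)^{H-\frac12}(v+n-1-x)^{H-\frac32}dv\Big)dx$, and for $n\ge1$ let $g_n^H=\sigma C_H\int_{n-1}^n x^{\frac12-H}(n-x)^{H-\frac12}\Big(\int_0^1(y(n-x)+x)^{H-\frac12}y^{H-\frac32}dy\Big)dx$. Let $(\xi_i)_{i\ge1}$ be i.i.d. with $P(\xi_i=1)=P(\xi_i=-1)=\frac12$, and $\mathcal{Y}_n^H=\sum_{i=1}^{n-1}j_n^H(i)\xi_i$ ($\mathcal{Y}_1^H=0$). For events $A_n$, $\{A_n\ \text{i.o.}\}=\bigcap_{n\ge1}\bigcup_{k\ge n}A_k$ and $\{A_n\ \text{ult.}\}=\bigcup_{n\ge1}\bigcap_{k\ge n}A_k$.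 Market objects: $k_H(t,s)=C_H s^{\frac12-H}\int_s^t u^{H-\frac12}(u-s)^{H-\frac32}du$; for $N>1$, $1\le i<n\le N$: $J_n^{(N,H)}(i)=\sigma\sqrt N\int_{(i-1)/N}^{i/N}(k_H(\frac nN,u)-k_H(\frac{n-1}N,u))du$; $g_n^{(N,H)}=\sigma\sqrt N\int_{(n-1)/N}^{n/N}k_H(\frac nN,u)du$; $a_n^{(N)}=\frac1Na(n/N)$; for $x\in\{-1,1\}^{n-1}$, $Y_n^{(N,H)}(x)=\sum_{i=1}^{n-1}J_n^{(N,H)}(i)x_i$ ($Y_1^{(N,H)}=0$), $u_n^{(N)}(x)=Y_n^{(N,H)}(x)+g_n^{(N,H)}$, $d_n^{(N)}(x)=Y_n^{(N,H)}(x)-g_n^{(N,H)}$. For $n\ge2$, $\mathcal{A}_n^{(N,H)}=\{x\in\{-1,1\}^{n-1}:u_n^{(N)}(x)\le-a_n^{(N)}\text{ or }d_n^{(N)}(x)\ge-a_n^{(N)}\}$; $\mathcal{A}_1^{(N,H)}$ is the one-element set containing the empty sequence if $u_1^{(N)}\le-a_1^{(N)}$ or $d_1^{(N)}\ge-a_1^{(N)}$, and $\emptyset$ otherwise. The set of arbitrage paths is $\mathcal{A}_\mathcal{P}^{(N,H)}=\{(x_1,\dots,x_{N-1})\in\{-1,1\}^{N-1}:\exists n\in\{1,\dots,N\},\ (x_1,\dots,x_{n-1})\in\mathcal{A}_n^{(N,H)}\}$. *)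

(* Defs.v *)
From HB Require Import structures.
From mathcomp Require Import all_boot all_order all_algebra.
From mathcomp Require Import all_classical all_reals all_analysis.

Set Implicit Arguments.
Unset Strict Implicit.
Unset Printing Implicit Defensive.
Import Order.TTheory GRing.Theory Num.Theory.
Import numFieldNormedType.Exports.
Local Open Scope classical_set_scope.
Local Open Scope ring_scope.

Section Defs.
Variable R : realType.
Notation leb := (@lebesgue_measure R).

Definition Gamma (z : R) : R :=
  \int[leb]_(t in `]0, +oo[) (powR t (z - 1) * expR (- t)).

Definition c_H (H : R) : R :=
  Num.sqrt ((2 * H * Gamma (3/2 - H)) / (Gamma (H + 1/2) * Gamma (2 - 2 * H))).

Definition C_H (H : R) : R := c_H H * (H - 1/2).

(* j_n^H(i), for 1 <= i < n *)
Definition jH (sigma H : R) (n i : nat) : R :=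
  sigma * C_H H *
  \int[leb]_(x in `[(i%:R - 1), i%:R]) (powR x (1/2 - H) *
     \int[leb]_(v in `[0, 1]) (powR (v + n%:R - 1) (H - 1/2) *
                               powR (v + n%:R - 1 - x) (H - 3/2))).

(* g_n^H, for n >= 1 *)
Definition gH (sigma H : R) (n : nat) : R :=
  sigma * C_H H *
  \int[leb]_(x in `[(n%:R - 1), n%:R]) (powR x (1/2 - H) * powR (n%:R - x) (H - 1/2) *
     \int[leb]_(y in `[0, 1]) (powR (y * (n%:R - x) + x) (H - 1/2) *
                               powR y (H - 3/2))).

(* i.i.d. sequence (xi_i)_{i >= 1} with P(xi_i = 1) = P(xi_i = -1) = 1/2;
   xi_i is [xi i]; [xi 0] is unused. *)
Definition iid_rademacher d (T : measurableType d) (P : probability T R)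
    (xi : nat -> {RV P >-> R}) : Prop :=
  (forall i : nat, (0 < i)%N ->
     P (xi i @^-1` [set 1]) = (1/2)%:E /\ P (xi i @^-1` [set -1]) = (1/2)%:E) /\
  (forall (I : seq nat) (B : nat -> set R),
     uniq I -> all (fun i => 0 < i)%N I -> (forall i, measurable (B i)) ->
     P (\bigcap_(i in [set` I]) (xi i @^-1` B i)) =
     \big[*%E/1%E]_(i <- I) P (xi i @^-1` B i)).

Definition YH d (T : measurableType d) (P : probability T R)
    (xi : nat -> {RV P >-> R}) (sigma H : R) (n : nat) (w : T) : R :=
  \sum_(1 <= i < n) jH sigma H n i * xi i w.

Definition io {T} (A : nat -> set T) : set T :=
  \bigcap_(n in [set n : nat | (1 <= n)%N]) \bigcup_(k in [set k : nat | (n <= k)%N]) A k.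
Definition ult {T} (A : nat -> set T) : set T :=
  \bigcup_(n in [set n : nat | (1 <= n)%N]) \bigcap_(k in [set k : nat | (n <= k)%N]) A k.

Definition kH (H t s : R) : R :=
  C_H H * powR s (1/2 - H) *
  \int[leb]_(u in `[s, t]) (powR u (H - 1/2) * powR (u - s) (H - 3/2)).

Definition JN (sigma H : R) (N n i : nat) : R :=
  sigma * Num.sqrt N%:R *
  \int[leb]_(u in `[(i%:R - 1) / N%:R, i%:R / N%:R])
     (kH H (n%:R / N%:R) u - kH H ((n%:R - 1) / N%:R) u).

Definition gN (sigma H : R) (N n : nat) : R :=
  sigma * Num.sqrt N%:R *
  \int[leb]_(u in `[(n%:R - 1) / N%:R, n%:R / N%:R]) kH H (n%:R / N%:R) u.

Definition aN (a : R -> R) (N n : nat) : R := (N%:R)^-1 * a (n%:R / N%:R).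

Definition sgnb (b : bool) : R := if b then 1 else -1.

(* a path x = (x_1,...,x_{N-1}) in {-1,1}^{N-1} is encoded by
   x : {ffun 'I_(N.-1) -> bool}, with x_{i+1} = sgnb (x i). *)
(* Y_n^{(N,H)} evaluated at the prefix (x_1,...,x_{n-1}) of x, for n <= N *)
#[local] Unset Implicit Arguments.
Definition YN (sigma H : R) (N n : nat) (x : {ffun 'I_(N.-1) -> bool}) : R :=
  \sum_(i < N.-1 | (i.+1 < n)%N) JN sigma H N n i.+1 * sgnb (x i).

Definition uN sigma H N n x : R := YN sigma H N n x + gN sigma H N n.
Definition dN sigma H N n x : R := YN sigma H N n x - gN sigma H N n.

(* (x_1,...,x_{n-1}) belongs to A_n^{(N,H)} (this covers n = 1 too,
   with the empty prefix and Y_1 = 0) *)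
Definition in_A (a : R -> R) (sigma H : R) (N n : nat) (x : {ffun 'I_(N.-1) -> bool}) : bool :=
  (uN sigma H N n x <= - aN a N n) || (- aN a N n <= dN sigma H N n x).

Definition arb_paths (a : R -> R) (sigma H : R) (N : nat) : {set {ffun 'I_(N.-1) -> bool}} :=
  [set x | [exists n : 'I_N.+1, (1 <= n)%N && in_A a sigma H N n x]].

End Defs.

(* Main.v *)
(* Let h = H - 1/2. Divided by sigma * C_H, the coefficient j_n(i) is at least
   1 / (n - i + 1), at most a constant times (n - 1 - i)^(2h - 1), and g_n lies between
   1 / (4 h) and 2 / h. Since j_n(i) -> 0 for fixed i, any finite past contributes at
   most 1 to Y_n once n is large. As the harmonic series diverges, forcing the last K
   signs to be +1 makes Y_n exceed any fixed level with probability at least 2^-(K+1)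
   (the signs in between are symmetric), whatever the past; hence Y_n > g_n infinitely
   often almost surely, for every H > 1/2. For h < 1/100 the variance of Y_n is at most
   252 while g_n > 25, so by Chebyshev |Y_n| <= g_n with probability at least 1/2,
   whatever the past, hence infinitely often. Thus Hc = 1/2 + 1/100 works. Finally
   J^(N)_n(i) = N^-H j_n(i) and g^(N)_n = N^-H g_n, whereas the drift is O(1/N), so the
   first argument, run on the uniform measure on paths, also gives arbitrage paths. *)
Require Import Defs.
From HB Require Import structures.
From mathcomp Require Import all_boot all_order all_algebra.
From mathcomp Require Import all_classical all_reals all_analysis.
From mathcomp Require Import measurable_realfun ring lra zify.
Import Order.TTheory GRing.Theory Num.Theory.
Import numFieldNormedType.Exports.
Local Open Scope classical_set_scope.
Local Open Scope ring_scope.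

Set Implicit Arguments.
Unset Strict Implicit.
Unset Printing Implicit Defensive.

(** * Averages over words of signs *)

(** The coefficients depend on n, so old signs re-enter [Y_n] with new weights each time, and it is
    not a random walk. What replaces independence of increments is a conditional frequency on finite
    words: after any past of length m, reading r further signs produces the event with frequency at
    least delta, where r may depend on m but delta may not. The same finite estimate then serves an
    i.i.d. sequence, through cylinders, and the uniform measure on paths, by counting. For small h
    the difficulty is uniformity. The threshold grows like 1 / h, so the variance must stay bounded
    as h tends to 0; the delicate coefficient is the one next to the diagonal, i = n - 1. The value
    1/100 makes 1 / (4 h) exceed 24 = 23 + 1, where [23^2 >= 2 * 252] is what Chebyshev asks for and
    the 1 accounts for the past. *)

Section word_average.
Variable R : realType.
Implicit Types (f g : seq bool -> R) (s p q : seq bool) (c : nat -> R).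

(** Expectation over n fair signs, [true] standing for +1. Peeling off the first letter turns
    conditioning on a prefix into [wavg_cat]. *)
Fixpoint wavg n f : R :=
  if n is n'.+1 then (wavg n' (f \o cons true) + wavg n' (f \o cons false)) / 2
  else f [::].

Lemma ler_wavg n f g :
  (forall s, size s = n -> f s <= g s) -> wavg n f <= wavg n g.
Proof.
elim: n f g => [|n IH] f g fg /=; first exact: fg.
rewrite ler_pM2r ?invr_gt0//; apply: lerD; apply: IH => s sn;
  by apply: fg; rewrite /= sn.
Qed.

Lemma eq_wavg n f g :
  (forall s, size s = n -> f s = g s) -> wavg n f = wavg n g.
Proof.
by move=> fg; apply: le_anti; rewrite !ler_wavg// => s sn; rewrite fg.
Qed.

Lemma wavgZ n a f : wavg n (fun s => a * f s) = a * wavg n f.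
Proof.
by elim: n f => [//|n IH] f /=; rewrite /comp !IH; ring.
Qed.

Lemma wavgD n f g : wavg n (fun s => f s + g s) = wavg n f + wavg n g.
Proof.
by elim: n f g => [//|n IH] f g /=; rewrite /comp !IH; ring.
Qed.

Lemma wavg_cst n a : wavg n (fun=> a) = a.
Proof. by elim: n => [//|n IH] /=; rewrite /comp !IH; lra. Qed.

Lemma wavg_cat m n f :
  wavg (m + n) f = wavg m (fun p => wavg n (fun q => f (p ++ q))).
Proof. by elim: m f => [//|m IH] f /=; rewrite !IH. Qed.

Lemma wavg_negb n f : wavg n (fun s => f (map negb s)) = wavg n f.
Proof.
elim: n f => [//|n IH] f /=.
by rewrite -(IH (f \o cons true)) -(IH (f \o cons false)) addrC.
Qed.

(** The word of n letters [true] has weight 2^-n, and the other words contribute nonnegatively. *)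
Lemma wavg_nseq_true n f : (forall s, 0 <= f s) ->
  2^-1 ^+ n * f (nseq n true) <= wavg n f.
Proof.
elim: n f => [|n IH] f f0 /=; first by rewrite expr0 mul1r.
have := IH (f \o cons true) (fun s => f0 _).
have : 0 <= wavg n (f \o cons false).
  by rewrite -(wavg_cst n 0); apply: ler_wavg => s _; exact: f0.
rewrite /= exprS; lra.
Qed.

(** Past the end of s the default [false] stands for the sign -1; size conditions below exclude this
    case where it would matter. *)
Definition wsum c n s : R := \sum_(i < n) c i * sgnb R (nth false s i).

Lemma wsum_cons c n b s :
  wsum c n.+1 (b :: s) = c 0 * sgnb R b + wsum (fun i => c i.+1) n s.
Proof. by rewrite /wsum big_ord_recl. Qed.

Lemma wsum_cat c m n p q : size p = m ->
  wsum c (m + n) (p ++ q) = wsum c m p + wsum (fun i => c (m + i)%N) n q.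
Proof.
move=> pm; rewrite /wsum big_split_ord /=; congr (_ + _); apply: eq_bigr => i _.
  by rewrite nth_cat pm ltn_ord.
by rewrite nth_cat pm -ltn_subRL subnn/= addKn.
Qed.

Lemma wsum_catl c m p q : (m <= size p)%N -> wsum c m (p ++ q) = wsum c m p.
Proof.
move=> pm; apply: eq_bigr => i _.
by rewrite nth_cat (leq_trans (ltn_ord i) pm).
Qed.

Lemma wsum_negb c n s : size s = n ->
  wsum c n (map negb s) = - wsum c n s.
Proof.
move=> sn; rewrite /wsum -sumrN; apply: eq_bigr => i _.
by rewrite (nth_map false) ?sn// /sgnb; case: nth => /=; ring.
Qed.

Lemma normr_sgnb b : `|sgnb R b| = 1.
Proof. by case: b; rewrite /= ?normrN normr1. Qed.

Lemma ler_norm_wsum c n s : (forall i, (i < n)%N -> 0 <= c i) ->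
  `|wsum c n s| <= \sum_(i < n) c i.
Proof.
move=> c0; apply: (le_trans (ler_norm_sum _ _ _)); apply: ler_sum => i _.
by rewrite normrM normr_sgnb mulr1 ger0_norm// c0.
Qed.

(** The two values of the first sign cancel the cross term. The offset a absorbs that first term, so
    that the induction hypothesis applies to the remaining letters. *)
Lemma wavg_sqr_wsum c n a :
  wavg n (fun s => (a + wsum c n s) ^+ 2) = a ^+ 2 + \sum_(i < n) c i ^+ 2.
Proof.
elim: n c a => [|n IH] c a /=; first by rewrite /wsum !big_ord0 !addr0.
have E b : wavg n ((fun s => (a + wsum c n.+1 s) ^+ 2) \o cons b) =
    (a + c 0 * sgnb R b) ^+ 2 + \sum_(i < n) c i.+1 ^+ 2.
  by rewrite -(IH (fun i => c i.+1)); apply: eq_wavg => s _ /=; rewrite wsum_cons addrA.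
by rewrite !E big_ord_recl /=; field.
Qed.

Lemma wavg_chebyshev c n (t : R) : 0 < t ->
  wavg n (fun s => (t < `|wsum c n s|)%R%:R) <= (\sum_(i < n) c i ^+ 2) / t ^+ 2.
Proof.
move=> t0; rewrite mulrC -[\sum_(i < n) _]add0r -[X in _ * (X + _)](expr0n R 2).
rewrite -wavg_sqr_wsum -wavgZ; apply: ler_wavg => s _; rewrite add0r.
case: ltP => [ts|_]; last by rewrite mulr_ge0 ?sqr_ge0// invr_ge0 sqr_ge0.
rewrite mulrC ler_pdivlMr ?exprn_gt0// mul1r -(real_normK (num_real (wsum _ _ _))).
by rewrite lerXn2r ?nnegrE ?(ltW t0)// ltW.
Qed.

(** A word and its letterwise negation have opposite sums, so at least one of the two counts, and
    negation preserves averages. *)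
Lemma wavg_wsum_ge0 c n : 2^-1 <= wavg n (fun s => (0 <= wsum c n s)%R%:R).
Proof.
have : 1 <= wavg n (fun s => (0 <= wsum c n s)%R%:R + (0 <= wsum c n (map negb s))%R%:R).
  rewrite -[leLHS](wavg_cst n); apply: ler_wavg => s sn; rewrite wsum_negb// oppr_ge0.
  by case: (leP 0 (wsum c n s)) => /= [_|/ltW ->]; rewrite ?lerDl ?lerDr.
rewrite wavgD (wavg_negb n (fun s => (0 <= wsum c n s)%R%:R)); lra.
Qed.

(* Conditionally on any history the event has probability at least delta
   some time later, so it fails k times in a row with probability at most
   (1 - delta)^k. *)
Lemma wavg_none_small (A : nat -> seq bool -> bool) delta :
  (forall m p q, (m <= size p)%N -> A m (p ++ q) = A m p) ->
  0 < delta ->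
  (forall m, exists r, forall p, size p = m ->
     delta <= wavg r (fun q => (A (m + r)%N (p ++ q))%:R)) ->
  forall n0 e, 0 < e -> exists m, forall M, (m <= M)%N ->
    wavg M (fun s => (all (fun n => ~~ A n s) (index_iota n0 m))%:R) <= e.
Proof.
move=> Aloc d0 Ad n0 e e0.
have d1 : delta <= 1.
  have [r /(_ [::] erefl) /le_trans] := Ad 0; apply.
  rewrite -[leRHS](wavg_cst r); apply: ler_wavg => s _.
  by case: (A _ _).
have [k kP] : exists k, (1 - delta) ^+ k <= e.
  have /cvgrPdist_le /(_ e e0) [k _ /(_ k (leqnn k))] :
      (fun n => (1 - delta) ^+ n) @ \oo --> (0 : R).
    by apply: cvg_expr; rewrite ger0_norm; lra.
  by rewrite /= sub0r normrN ger0_norm ?exprn_ge0 ?subr_ge0// => ?; exists k.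
suff [m [_ mP]] : exists m, (n0 <= m)%N /\ forall M, (m <= M)%N ->
    wavg M (fun s => (all (fun n => ~~ A n s) (index_iota n0 m))%:R)
      <= (1 - delta) ^+ k.
  by exists m => M /mP/le_trans; apply.
elim: k {kP} => [|k [m [n0m IH]]].
  exists n0; split=> // M _; rewrite expr0 -[leRHS](wavg_cst M).
  by apply: ler_wavg => s _; case: all.
(* [index_iota] excludes its upper end; the successor makes the new trial, at time m + r, part of
   the range. *)
have [r rP] := Ad m; exists (m + r).+1; split; first by lia.
move=> M rM; have -> : M = (m + (r + (M - (m + r))))%N by lia.
rewrite wavg_cat; apply: (@le_trans _ _ (wavg m (fun p =>
  (1 - delta) * (all (fun n => ~~ A n p) (index_iota n0 m))%:R))); last first.
  by rewrite wavgZ exprS ler_wpM2l ?subr_ge0// IH.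
apply: ler_wavg => p pm.
apply: (@le_trans _ _ (wavg r (fun q =>
    (1 - (A (m + r)%N (p ++ q))%:R) *
    (all (fun n => ~~ A n p) (index_iota n0 m))%:R))); last first.
  rewrite (_ : wavg r _ = wavg r (fun q =>
     (all (fun n => ~~ A n p) (index_iota n0 m))%:R *
     (1 + (-1) * (A (m + r)%N (p ++ q))%:R))); last first.
    by apply: eq_wavg => q _; rewrite mulrC mulN1r.
  rewrite wavgZ wavgD wavg_cst wavgZ mulrC mulN1r ler_wpM2r//.
  by rewrite lerD2l lerN2 rP.
rewrite wavg_cat; apply: ler_wavg => q qr.
rewrite -[leRHS](wavg_cst (M - (m + r))); apply: ler_wavg => t _.
case: (boolP (all _ _)) => [/allP al|_]; last first.
  by rewrite mulr_ge0 ?subr_ge0 ?ler_nat// lern1; case: (A _ _).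
have /negPf -> : ~~ A (m + r)%N (p ++ q).
  rewrite -(Aloc _ _ t) ?size_cat ?pm ?qr// -catA; apply: al.
  by rewrite mem_index_iota; lia.
rewrite subr0 mul1r; suff -> : all (fun n => ~~ A n p) (index_iota n0 m) by [].
apply/allP => n; rewrite mem_index_iota => nm.
rewrite -(Aloc _ _ (q ++ t)); last by rewrite pm; lia.
by apply: al; rewrite mem_index_iota; lia.
Qed.

End word_average.

(** * Signed sums with a triangular array of weights whose columns tend to 0 *)

Section random_signs.
Variable R : realType.
Variable a : nat -> nat -> R.
Hypothesis a_ge0 : forall N i, (i < N)%N -> 0 <= a N i.
Hypothesis a_cvg0 : forall i e, 0 < e ->
  exists N0, forall N, (N0 <= N)%N -> a N i <= e.

Lemma sum_prefix_small m : exists N0, forall N, (N0 <= N)%N ->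
  \sum_(i < m) a N i <= 1.
Proof.
(* With an arbitrary bound e, the induction can give half of it to the newly added column. *)
suff H e : 0 < e -> exists N0, forall N, (N0 <= N)%N -> \sum_(i < m) a N i <= e.
  exact: H.
elim: m e => [|m IH] e e0; first by exists 0 => N _; rewrite big_ord0 ltW.
have e20 : 0 < e / 2 by rewrite divr_gt0.
have [N1 N1P] := IH _ e20; have [N2 N2P] := a_cvg0 m e20.
exists (N1 + N2)%N => N NN; rewrite big_ord_recr /=.
have := N1P N ltac:(lia); have := N2P N ltac:(lia); lra.
Qed.

(** [delta] is computed from K alone, hence from C and not from m; only r, which pushes the row
    beyond N0 and N1, depends on m. *)
Lemma wsum_frequently_large :
  (forall C, exists K N0, forall N, (N0 <= N)%N ->
     C <= \sum_(i < K) a N (N - K + i)%N) ->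
  forall C : R, exists2 delta : R, 0 < delta & forall m, exists r, forall p,
    size p = m ->
    delta <= wavg r (fun q =>
      (C <= wsum (a (m + r)%N) (m + r)%N (p ++ q))%R%:R).
Proof.
(* The extra 1 compensates the past, whose signed sum is at least -1. *)
move=> a_dvg C; have [K [N0 KP]] := a_dvg (C + 1).
exists (2^-1 ^+ K * 2^-1); first by rewrite mulr_gt0 ?exprn_gt0 ?invr_gt0.
move=> m; have [N1 N1P] := sum_prefix_small m.
pose r := (N0 + N1)%N; exists (r + K)%N => p pm; set N := (m + (r + K))%N.
have pS : -1 <= wsum (a N) m p.
  have := ler_norm_wsum (c := a N) (n := m) p.
  move=> /(_ (fun i im => a_ge0 (N := N) (i := i) ltac:(rewrite /N; lia))) /le_trans.
  by move=> /(_ _ (N1P N ltac:(rewrite /N/r; lia))); rewrite ler_norml => /andP[].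
have KS : C + 1 <= \sum_(i < K) a N (m + (r + i))%N.
  apply: (le_trans (KP N ltac:(rewrite /N/r; lia))).
  by rewrite le_eqVlt; apply/orP; left; apply/eqP; apply: eq_bigr => i _; congr (a N _); rewrite /N; lia.
rewrite wavg_cat.
apply: (@le_trans _ _ (wavg r (fun q => 2^-1 ^+ K *
    (0 <= wsum (fun i => a N (m + i)%N) r q)%R%:R))).
  by rewrite wavgZ ler_wpM2l ?exprn_ge0 ?invr_ge0// wavg_wsum_ge0.
apply: ler_wavg => q qr.
apply: (le_trans _ (wavg_nseq_true _ _)) => //.
rewrite ler_wpM2l ?exprn_ge0 ?invr_ge0// ler_nat.
case: leP => //= V0; rewrite lt0b wsum_cat// wsum_cat//.
rewrite [X in _ + (_ + X)](_ : _ = \sum_(i < K) a N (m + (r + i))%N); first lra.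
by apply: eq_bigr => i _; rewrite nth_nseq ltn_ord mulr1.
Qed.

(** Chebyshev at level t is applied to the signs after p only, and [2 * D <= t ^+ 2] brings it down
    to 1/2. The past adds at most 1, hence t + 1. *)
Lemma wsum_frequently_small (D t : R) : 0 < t -> 2 * D <= t ^+ 2 ->
  (exists N0, forall N, (N0 <= N)%N -> \sum_(i < N) a N i ^+ 2 <= D) ->
  forall m, exists r, forall p, size p = m ->
    (2^-1 : R) <= wavg r (fun q =>
      (`|wsum (a (m + r)%N) (m + r)%N (p ++ q)| <= t + 1)%R%:R).
Proof.
move=> t0 Dt [N0 N0P] m; have [N1 N1P] := sum_prefix_small m.
pose r := (N0 + N1)%N; exists r => p pm; set N := (m + r)%N.
have pS : `|wsum (a N) m p| <= 1.
  apply: le_trans (N1P N ltac:(rewrite /N/r; lia)); apply: ler_norm_wsum => i im.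
  by apply: a_ge0; rewrite /N; lia.
have : wavg r (fun q => (t < `|wsum (fun i => a N (m + i)%N) r q|)%R%:R) <= (2^-1 : R).
  apply: (le_trans (wavg_chebyshev (fun i => a N (m + i)%N) r t0)); rewrite ler_pdivrMr ?exprn_gt0//.
  suff : \sum_(i < r) a N (m + i)%N ^+ 2 <= D by lra.
  apply: le_trans (N0P N ltac:(rewrite /N/r; lia)).
  by rewrite /N [leRHS]big_split_ord /= lerDr sumr_ge0// => i _; exact: sqr_ge0.
(* For each word either the whole sum is at most t + 1 or the new part exceeds t, so the two
   frequencies add up to at least 1. *)
suff : (1 : R) <= wavg r (fun q => (`|wsum (a N) N (p ++ q)| <= t + 1)%R%:R +
    (t < `|wsum (fun i => a N (m + i)%N) r q|)%R%:R) by rewrite wavgD; lra.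
rewrite -[leLHS](wavg_cst r); apply: ler_wavg => q qr; rewrite wsum_cat//.
case: (ltP t) => [_|Vt]; first by rewrite lerDr.
rewrite addr0 ler1n lt0b; apply: (le_trans (ler_normD _ _)).
by rewrite addrC lerD.
Qed.

End random_signs.

(** * From words to an i.i.d. sequence of signs *)

Section rademacher.
Context (R : realType) d (T : measurableType d) (P : probability T R).
Variable xi : nat -> {RV P >-> R}.
Hypothesis xi_iid : iid_rademacher xi.

Definition cylinder (p : seq bool) : set T :=
  [set w | forall i, (i < size p)%N -> xi i.+1 w = sgnb R (nth false p i)].

(** The shape to which the independence clause of [iid_rademacher] applies; letter i is read from
    [xi i.+1] because the signs are numbered from 1. *)
Lemma cylinderE p : cylinder p = \bigcap_(i in [set` iota 1 (size p)])
  (xi i @^-1` [set sgnb R (nth false p i.-1)]).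
Proof.
apply/seteqP; split=> w pw.
  by move=> [|i] /=; rewrite mem_iota ?add1n ?ltnS// => /andP[_ ?]; exact: pw.
by move=> i ip; apply: (pw i.+1); rewrite /= mem_iota /= add1n ltnS.
Qed.

Lemma measurable_cylinder p : measurable (cylinder p).
Proof.
rewrite cylinderE; apply: fin_bigcap_measurable => [|i _]; first exact: finite_seq.
by rewrite -[X in measurable X]setTI; exact: measurable_funPT.
Qed.

Lemma prob_cylinder p : P (cylinder p) = (2^-1 ^+ size p)%:E.
Proof.
have [xi1 xiI] := xi_iid.
rewrite cylinderE (xiI (iota 1 (size p)) (fun i => [set sgnb R (nth false p i.-1)])).
- rewrite -[in RHS](size_iota 1 (size p)) big_seq.
  rewrite (eq_bigr (fun=> (2^-1)%:E)) => [|i].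
    rewrite -big_seq; elim: (iota _ _) => [|i s IH]; first by rewrite big_nil.
    by rewrite big_cons IH -EFinM exprS.
  rewrite mem_iota => /andP[i1 _]; have [H1 H2] := xi1 _ i1.
  by case: nth; rewrite /sgnb ?H1 ?H2 div1r.
- exact: iota_uniq.
- by apply/allP => i; rewrite mem_iota => /andP[].
- by move=> i; exact: measurable_set1.
Qed.

(** Up to a null set, E is covered by cylinders of words of length M, each of mass 2^-M, and meets
    only those whose word satisfies Q. *)
Lemma prob_le_wavg E M (Q : seq bool -> bool) : measurable E ->
  (forall w s, E w -> size s = M -> cylinder s w -> Q s) ->
  (P E <= (wavg M (fun s => (Q s)%:R))%:E)%E.
Proof.
move=> mE EQ.
(* Generalized to the part of E inside a cylinder, for an induction on the number of signs still to
   be read. *)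
suff H r p : (size p + r = M)%N -> (P (E `&` cylinder p) <=
    (2^-1 ^+ size p * wavg r (fun q => (Q (p ++ q))%:R))%:E)%E.
  have := H M [::] erefl; rewrite expr0 mul1r; apply: le_trans.
  rewrite le_measure ?inE//; first by apply: measurableI => //; exact: measurable_cylinder.
elim: r p => [|r IH] p.
  rewrite addn0 => pM /=; rewrite cats0.
  case: (boolP (Q p)) => [_|Qp].
    rewrite mulr1 -prob_cylinder le_measure ?inE//.
    + by apply: measurableI => //; exact: measurable_cylinder.
    + exact: measurable_cylinder.
  rewrite (_ : E `&` _ = set0) ?measure0 ?mulr0//.
  by apply/seteqP; split=> // w [Ew pw]; move/negP: Qp; apply; exact: EQ pw.
(* The variables are signs only almost surely; N is the null set where the next one is neither 1 nor
   -1. *)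
move=> prM; pose N : set T := ~` (xi (size p).+1 @^-1` [set 1; -1]).
have mX (B : set R) i : measurable B -> measurable (xi i @^-1` B).
  by move=> mB; rewrite -[X in measurable X]setTI; exact: measurable_funPT.
have mN : measurable N.
  by apply: measurableC; apply: mX; apply: measurableU; exact: measurable_set1.
have PN : P N = 0%E.
  rewrite /N probability_setC; last by apply: mX; apply: measurableU; exact: measurable_set1.
  rewrite preimage_setU measureU; last 3 first.
  - by apply: mX; exact: measurable_set1.
  - by apply: mX; exact: measurable_set1.
  - apply/seteqP; split=> // w [/= ->] /eqP.
    by rewrite -subr_eq0 opprK (_ : 1 + 1 = 2%:R)// pnatr_eq0.
  have [E1 E2] := xi_iid.1 (size p).+1 isT.
  transitivity (1 - ((1 / 2)%:E + (1 / 2)%:E) : \bar R)%E.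
    by congr (_ - (_ + _))%E; [exact: E1|exact: E2].
  have -> : ((1 / 2)%:E + (1 / 2)%:E = 1 :> \bar R)%E by rewrite -EFinD -splitr.
  by rewrite subee.
have mEc s : measurable (E `&` cylinder s).
  by apply: measurableI => //; exact: measurable_cylinder.
apply: (@le_trans _ _ (P ((E `&` cylinder (rcons p true)) `|`
    (E `&` cylinder (rcons p false)) `|` N))).
  rewrite le_measure ?inE//; first by do 2 apply: measurableU => //.
  move=> w [Ew pw]; case: (pselect (N w)) => [|/contrapT]; first by right.
  move=> /= xp; left; case: xp => xp; [left|right]; split=> // i;
    rewrite size_rcons ltnS leq_eqVlt nth_rcons => /predU1P[->|ip];
    rewrite ?ltnn ?eqxx ?xp// ip; exact: pw.
apply: (le_trans (measureU2 _ _ _)) => //; first exact: measurableU.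
rewrite [X in (_ + X)%E](_ : _ = 0%E) ?adde0; last exact: PN.
apply: (le_trans (measureU2 _ _ _)) => //.
have IHb b := IH (rcons p b) ltac:(by rewrite size_rcons addSnnS).
apply: (le_trans (leeD (IHb true) (IHb false))).
rewrite -EFinD lee_fin !size_rcons exprSr /=.
have E1 b : wavg r (fun q => (Q (rcons p b ++ q))%:R) =
    wavg r ((fun q => (Q (p ++ q))%:R) \o cons b) :> R.
  by apply: eq_wavg => s _ /=; rewrite cat_rcons.
by rewrite !E1 le_eqVlt; apply/orP; left; apply/eqP; ring.
Qed.

(** For every m, a point of E in the cylinder of a word of length m forces that word to avoid all
    [A n] with n0 <= n < m, and [wavg_none_small] makes such words arbitrarily rare. *)
Lemma prob_never_eq0 (A : nat -> seq bool -> bool) (delta : R) (E : set T) n0 :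
  (forall m p q, (m <= size p)%N -> A m (p ++ q) = A m p) ->
  0 < delta ->
  (forall m, exists r, forall p, size p = m ->
     delta <= wavg r (fun q => (A (m + r)%N (p ++ q))%:R)) ->
  measurable E ->
  (forall w s n, E w -> cylinder s w -> (n0 <= n <= size s)%N -> ~~ A n s) ->
  P E = 0%E.
Proof.
move=> Aloc d0 Ad mE EA; apply/eqP; rewrite eq_le measure_ge0 andbT.
apply/lee_addgt0Pr => e e0; rewrite add0e.
have [m mP] := wavg_none_small Aloc d0 Ad n0 e0.
apply: (le_trans _ (_ : (wavg m (fun s =>
    (all (fun n => ~~ A n s) (index_iota n0 m))%:R))%:E <= e%:E)%E); last first.
  by rewrite lee_fin mP.
apply: prob_le_wavg => // w s Ew sm ws; apply/allP => n.
rewrite mem_index_iota => nm; apply: EA Ew ws _.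
by rewrite sm; lia.
Qed.

End rademacher.

(** * Averages over words as proportions of sign paths *)

Fixpoint words n : seq (seq bool) :=
  if n is n'.+1 then map (cons true) (words n') ++ map (cons false) (words n')
  else [:: [::]].

Lemma mem_words n s : (s \in words n) = (size s == n).
Proof.
elim: n s => [|n IH] [|b s] /=; rewrite ?mem_seq1// mem_cat.
  by apply/negP => /orP[] /mapP[].
have injc c : injective (cons c : seq bool -> seq bool) by move=> x y [].
rewrite eqSS -IH; case: b; first rewrite mem_map//; last rewrite orbC mem_map//.
  by case: (s \in _) => //=; apply/mapP => -[].
by case: (s \in _) => //=; apply/mapP => -[].
Qed.

Lemma words_uniq n : uniq (words n).
Proof.
have injc c : injective (cons c : seq bool -> seq bool) by move=> x y [].
elim: n => [//|n IH] /=; rewrite cat_uniq !map_inj_uniq// IH /= andbT.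
by apply/hasPn => s /mapP[t _ ->]; apply/mapP => -[].
Qed.

Lemma wavgE (R : realType) n (f : seq bool -> R) :
  wavg n f = (\sum_(s <- words n) f s) / 2 ^+ n.
Proof.
elim: n f => [|n IH] f /=; first by rewrite big_seq1 expr0 divr1.
rewrite !IH big_cat !big_map exprS /= -mulrDl -mulrA; congr (_ * _).
by rewrite invfM mulrC.
Qed.

(** [codom] is a bijection from the finite functions on ['I_N] to the words of length N. *)
Lemma wavg_card (R : realType) N (Q : seq bool -> bool) :
  wavg N (fun s => (Q s)%:R) =
  #|[pred x : {ffun 'I_N -> bool} | Q (codom x)]|%:R / 2 ^+ N :> R.
Proof.
rewrite wavgE; congr (_ / _).
rewrite (perm_big [seq codom x | x : {ffun 'I_N -> bool}]).
  rewrite /image_mem big_map big_enum /= -sum1_card natr_sum big_mkcond [RHS]big_mkcond.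
  by apply: eq_bigr => x _; rewrite inE; case: (Q _).
apply: uniq_perm; first exact: words_uniq.
  rewrite map_inj_uniq ?enum_uniq// => x y xy; apply/ffunP => i.
  have /= := congr1 (fun s => nth false s i) xy.
  have := nth_codom false x (enum_rank i); rewrite enum_rankK.
  by have := nth_codom false y (enum_rank i); rewrite !enum_rankK enum_rank_ord => -> ->.
move=> s; rewrite mem_words; apply/eqP/mapP => [sN|[x _ ->]]; last first.
  by rewrite size_codom card_ord.
exists [ffun i : 'I_N => nth false s i]; first by rewrite mem_enum.
apply: (@eq_from_nth _ false) => [|i]; first by rewrite size_codom card_ord.
rewrite sN => iN; have := nth_codom false [ffun i : 'I_N => nth false s i] (enum_rank (Ordinal iN)).
by rewrite enum_rankK enum_rank_ord /= ffunE /= => ->.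
Qed.

(** * Lebesgue integrals on the line *)

Section integral_bounds.
Context {R : realType}.
Notation mu := (@lebesgue_measure R).
Implicit Types (f g : R -> R) (D : set R).

Lemma measurable_affine (c d : R) : measurable_fun [set: R] (fun x => c * x + d).
Proof. by apply: measurable_funD => //; apply: measurable_funM. Qed.

(** Uniqueness of Lebesgue measure: the rescaled pushforward has the right value on half-open
    intervals. For c < 0 the preimage is half-open at the other end, which does not change its
    length. *)
Lemma lebesgue_measure_affine (c d : R) (A : set R) : c != 0 -> measurable A ->
  mu A = (`|c|%:E * mu ((fun x => c * x + d)%R @^-1` A))%E.
Proof.
move=> c0 mA.
pose m maf : {measure set (measurableTypeR R) -> \bar R} :=
  mscale (NngNum (normr_ge0 c))
    (@measure_function_pushforward__canonical__measure_function_Measure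
       _ _ _ (measurableTypeR R) R mu (fun x => c * x + d) maf).
rewrite (@lebesgue_measure_unique R (m (measurable_affine c d)))//= => _ [[a b] _ <-].
rewrite /m /mscale/= /pushforward.
have [cp|cn|] := ltgtP c 0; last by move/eqP: c0.
- rewrite (_ : _ @^-1` _ = `[(b - d) / c, (a - d) / c[%classic); last first.
    apply/seteqP; split=> x /=; rewrite !in_itv /=;
    by rewrite ler_ndivrMr// ltr_ndivlMr// mulrC lerBrDr ltrBlDr andbC.
  rewrite !lebesgue_measure_itv/= !lte_fin ltr_ndivlMr// divfK// ltrD2r.
  case: ifP => _; last by rewrite mule0.
  by rewrite -!EFinB -EFinM ltr0_norm//; congr (_%:E); field.
- rewrite (_ : _ @^-1` _ = `](a - d) / c, (b - d) / c]%classic); last first.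
    apply/seteqP; split=> x /=; rewrite !in_itv /=;
    by rewrite ler_pdivlMr// ltr_pdivrMr// mulrC lerBrDr ltrBlDr.
  rewrite !lebesgue_measure_itv/= !lte_fin ltr_pdivrMr// divfK// ltrD2r.
  case: ifP => _; last by rewrite mule0.
  by rewrite -!EFinB -EFinM gtr0_norm//; congr (_%:E); field.
Qed.

(** Negative c is included for the sake of the reflection x -> n - 1 - x near the diagonal. *)
Lemma ge0_integral_affine (c d : R) D f : c != 0 -> measurable D ->
  measurable_fun [set: R] f -> (forall x, 0 <= f x) ->
  (\int[mu]_(x in D) (f x)%:E =
   `|c|%:E * \int[mu]_(x in (fun x => c * x + d)%R @^-1` D) (f (c * x + d)%R)%:E)%E.
Proof.
move=> c0 mD mf f0; have maf := measurable_affine c d.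
have mfD : measurable_fun D (EFin \o f) by apply/measurable_EFinP; exact: measurable_funTS.
rewrite -(@ge0_integral_pushforward _ _ (measurableTypeR R) (measurableTypeR R) R _ maf mu D (EFin \o f))//; last first.
  by move=> y _; rewrite lee_fin.
rewrite -(@ge0_integral_mscale _ _ R (@measure_function_pushforward__canonical__measure_function_Measure
   _ _ _ (measurableTypeR R) R mu _ maf) D mD (NngNum (normr_ge0 c)))//; last first.
  by move=> x _; rewrite lee_fin.
apply: eq_measure_integral => A mA _.
exact: lebesgue_measure_affine.
Qed.

Lemma fineZl (c : R) (x : \bar R) : 0 <= c -> fine (c%:E * x) = c * fine x.
Proof.
rewrite le_eqVlt => /predU1P[<-|c0]; first by rewrite mul0e mul0r.
by case: x => [r //||] /=; rewrite ?gt0_muley ?gt0_muleNy ?lte_fin//= mulr0.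
Qed.

Lemma Rintegral_affine (a b c d : R) f : 0 < c ->
  measurable_fun [set: R] f -> (forall x, 0 <= f x) ->
  \int[mu]_(x in `[c * a + d, c * b + d]) f x =
  c * \int[mu]_(x in `[a, b]) f (c * x + d).
Proof.
move=> c0 mf f0; rewrite /Rintegral (@ge0_integral_affine c d)// ?gt_eqF//.
rewrite fineZl// gtr0_norm//; congr (_ * fine _).
rewrite (_ : _ @^-1` _ = `[a, b]%classic)//; apply/seteqP.
by split=> x /=; rewrite !in_itv /= !lerD2r !ler_pM2l.
Qed.

Lemma ge0_RintegralZl D f (c : R) : measurable D -> measurable_fun D f ->
  (forall x, D x -> 0 <= f x) -> 0 <= c ->
  \int[mu]_(x in D) (c * f x) = c * \int[mu]_(x in D) f x.
Proof.
move=> mD mf f0 c0; rewrite /Rintegral -fineZl//.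
by rewrite -ge0_integralZl//; exact/measurable_EFinP.
Qed.

(** Stated for the extended integral, so that it certifies finiteness as well: the real-valued
    integral is 0 when the extended one is infinite, and a bound on it would say nothing. *)
Definition int_le D f (C : R) := (\int[mu]_(x in D) (f x)%:E <= C%:E)%E.

Lemma int_le_mono D f g C : measurable D ->
  measurable_fun D f -> measurable_fun D g ->
  (forall x, D x -> 0 <= f x <= g x) -> int_le D g C -> int_le D f C.
Proof.
move=> mD mf mg fg; apply: le_trans; apply: ge0_le_integral => //.
- by move=> x /fg /andP[]; rewrite lee_fin.
- exact/measurable_EFinP.
- exact/measurable_EFinP.
- by move=> x /fg /andP[]; rewrite lee_fin.
Qed.

Lemma int_leZ D f C c : measurable D -> measurable_fun D f ->
  (forall x, D x -> 0 <= f x) -> 0 <= c ->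
  int_le D f C -> int_le D (fun x => c * f x) (c * C).
Proof.
move=> mD mf f0 c0 fC; rewrite /int_le.
under eq_integral do rewrite EFinM.
rewrite ge0_integralZl//; last exact/measurable_EFinP.
by rewrite EFinM lee_wpmul2l ?lee_fin.
Qed.

Lemma int_le_cst (a b : R) (C : R) : a <= b -> int_le `[a, b] (fun=> C) (C * (b - a)).
Proof.
move=> ab; rewrite /int_le integral_cst//= lebesgue_measure_itv/= lte_fin.
case: ltP => ba; first by rewrite -EFinB -EFinM.
by rewrite mule0 lee_fin (_ : b = a) ?subrr ?mulr0//; lra.
Qed.

Lemma integral_ge0_fin D f C : (forall x, D x -> 0 <= f x) -> int_le D f C ->
  (\int[mu]_(x in D) (f x)%:E)%E \is a fin_num.
Proof.
move=> f0 fC; rewrite ge0_fin_numE; first exact: le_lt_trans fC (ltry _).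
by apply: integral_ge0 => x Dx; rewrite lee_fin f0.
Qed.

Lemma Rintegral_le D f C : (forall x, D x -> 0 <= f x) -> int_le D f C ->
  \int[mu]_(x in D) f x <= C.
Proof.
move=> f0 fC; rewrite -lee_fin /Rintegral fineK//.
exact: integral_ge0_fin fC.
Qed.

(** [int_le D f C] serves to exclude an infinite integral, whose real value 0 would break the lower
    bound. *)
Lemma Rintegral_ge D A f (C c : R) l : measurable D -> measurable_fun D f ->
  (forall x, D x -> 0 <= f x) -> int_le D f C ->
  measurable A -> A `<=` D -> mu A = l%:E -> 0 <= c ->
  (forall x, A x -> c <= f x) -> c * l <= \int[mu]_(x in D) f x.
Proof.
move=> mD mf f0 fC mA AD Al c0 cf; rewrite -lee_fin /Rintegral fineK; last first.
  exact: integral_ge0_fin fC.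
apply: (@le_trans _ _ (\int[mu]_(x in A) (f x)%:E)%E); last first.
  by apply: ge0_subset_integral => //; exact/measurable_EFinP.
rewrite EFinM -Al -(@integral_cst _ _ _ mu A mA c%:E).
apply: ge0_le_integral => //.
- by apply/measurable_EFinP; exact: measurable_funS mf.
Qed.

Lemma integrable_int_le D f C : measurable D -> measurable_fun D f ->
  (forall x, D x -> 0 <= f x) -> int_le D f C -> mu.-integrable D (EFin \o f).
Proof.
move=> mD mf f0 fC; apply/integrableP; split; first exact/measurable_EFinP.
apply: le_lt_trans (ltry C); apply: le_trans fC; rewrite le_eqVlt; apply/orP; left.
by apply/eqP/eq_integral => x /[!inE] Dx /=; rewrite ger0_norm ?f0.
Qed.

(** Tonelli; the indicator of D turns the inner integral into one over the whole line. *)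
Lemma measurable_Rintegral_param (F : R * R -> R) (D : set R) : measurable D ->
  measurable_fun [set: R * R] F -> (forall z, 0 <= F z) ->
  measurable_fun [set: R] (fun x => \int[mu]_(v in D) F (x, v)).
Proof.
move=> mD mF F0.
pose G (z : R * R) : \bar R := ((F z) * \1_D z.2)%:E.
have mG : measurable_fun setT G.
  apply/measurable_EFinP; apply: measurable_funM => //.
  by apply: measurableT_comp => //; exact: measurable_indic.
have := @measurable_fun_fubini_tonelli_F _ _ _ _ _ mu G mG.
move=> /(_ (fun z => ltac:(by rewrite lee_fin mulr_ge0))) mGF.
rewrite (_ : (fun x => _) = fine \o fubini_F mu G); first exact: measurableT_comp.
apply/funext => x; rewrite /= /Rintegral /fubini_F integral_mkcond; congr fine.
apply: eq_integral => v _; rewrite /G patchE indicE.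
by case: (v \in D); rewrite ?mulr1 ?mulr0.
Qed.

(** For p < 0 the integral is improper at 0, so ]0, 1] is exhausted by the intervals [1/(i+1), 1]:
    the fundamental theorem of calculus applies on each, and monotone convergence gives the
    limit. *)
Lemma integral_powR01 (p : R) : -1 < p ->
  (\int[mu]_(x in `[0%R, 1%R]) (x `^ p)%:E = ((p + 1)^-1)%:E)%E.
Proof.
move=> p1; have p0 : 0 < p + 1 by lra.
rewrite -integral_itv_obnd_cbnd; last first.
  by apply/measurable_EFinP; apply: measurable_funTS; exact: measurable_powR.
pose F (i : nat) := `[@harmonic R i, 1]%classic : set R.
have UF : \bigcup_i F i = `]0, 1]%classic.
  apply/seteqP; split=> [x [i _]|x]; rewrite /F /= !in_itv /=.
    by move=> /andP[ix ->]; rewrite andbT (lt_le_trans _ ix)// harmonic_gt0.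
  move=> /andP[x0 x1]; have /cvgrPdist_lt /(_ _ x0) [i _ /(_ i (leqnn i))] := @cvg_harmonic R.
  rewrite /= sub0r normrN ger0_norm ?harmonic_ge0// => ix.
  by exists i => //; rewrite /F/= in_itv/= x1 ltW.
have H1 : (fun i => \int[mu]_(x in F i) (x `^ p)%:E)%E @ \oo -->
   (\int[mu]_(x in `]0%R, 1%R]) (x `^ p)%:E)%E.
  rewrite -UF; apply: ge0_nondecreasing_set_cvg_integral => //.
  - apply/nondecreasing_seqP => i; apply/subsetPset => x; rewrite /F/= !in_itv/=.
    move=> /andP[ix ->]; rewrite andbT (le_trans _ ix)// lef_pV2 ?posrE ?ltr0n//.
    by rewrite ler_nat.
  - by move=> i; exact: measurable_itv.
  - by move=> i; apply/measurable_EFinP; apply: measurable_funTS; exact: measurable_powR.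
  - by move=> i x _; rewrite lee_fin powR_ge0.
have FE i : (\int[mu]_(x in F i) (x `^ p)%:E)%E =
    ((1 - harmonic i `^ (p + 1)) / (p + 1))%:E.
  have i0 : 0 < @harmonic R i := harmonic_gt0 i.
  (* For i = 0 the interval is the single point 1, which is treated apart from the proper
     intervals. *)
  have : @harmonic R i <= 1 by rewrite invf_le1 ?ltr0n// ler1n.
  rewrite le_eqVlt => /predU1P[i1|i1].
    by rewrite /F i1 set_itv1 integral_set1 powR1 subrr mul0r.
  have ip x : x \in `]harmonic i, 1[ -> 0 < x.
    by rewrite in_itv/= => /andP[ix _]; exact: lt_trans ix.
  have cpow q x : 0 < x -> {for x, continuous (fun y : R => y `^ q)}.
    move=> x0; apply: differentiable_continuous; apply/derivable1_diffP.
    by apply: derivable_powR; rewrite in_itv/= x0.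
  rewrite (@continuous_FTC2 R (fun x => x `^ p) (fun x => (p + 1)^-1 * x `^ (p + 1)))//.
  - by rewrite -EFinB powR1; congr (_%:E); field; rewrite gt_eqF.
  - apply/continuous_within_itvP => //; split.
    + by move=> x /ip x0; exact: cpow.
    + by apply: cvg_at_right_filter; exact: cpow.
    + by apply: cvg_at_left_filter; exact: cpow.
  - split.
    + move=> x /ip x0; apply: derivableM => //.
      by apply: derivable_powR; rewrite in_itv/= x0.
    + by apply: cvg_at_right_filter; apply: cvgM; [exact: cvg_cst|exact: cpow].
    + by apply: cvg_at_left_filter; apply: cvgM; [exact: cvg_cst|exact: cpow].
  - move=> x /ip x0; rewrite derive1Ml; last by apply: derivable_powR; rewrite in_itv/= x0.
    rewrite powR_derive1 ?in_itv/= ?x0// mulrA mulVf ?gt_eqF// mul1r.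
    by rewrite addrK.
have H2 : (fun i => \int[mu]_(x in F i) (x `^ p)%:E)%E @ \oo --> ((p + 1)^-1)%:E.
  under eq_fun do rewrite FE.
  apply: cvg_EFin; first by near=> i.
  suff : (fun i => (1 - harmonic i `^ (p + 1)) / (p + 1)) @ \oo --> (1 - 0) / (p + 1).
    by rewrite subr0 mul1r.
  apply: cvgM; last exact: cvg_cst.
  apply: cvgB; first exact: cvg_cst.
  have /cvg_at_rightP := @powR_cvg0 R (p + 1) p0; apply.
  by split=> [i|]; [exact: harmonic_gt0|exact: cvg_harmonic].
exact: (cvg_unique _ H1 H2).
Unshelve. all: by end_near. Qed.

End integral_bounds.

(** * Bounds on the coefficients *)

Section kernel_bounds.
Context {R : realType}.
Notation mu := (@lebesgue_measure R).

Lemma ler_npowR (p x y : R) : p <= 0 -> 0 < x -> x <= y -> y `^ p <= x `^ p.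
Proof.
move=> p0 x0 xy; have y0 : 0 < y := lt_le_trans x0 xy.
have E z : z `^ p = (z `^ (- p))^-1 by rewrite -powRN opprK.
rewrite (E x) (E y) lef_pV2 ?posrE ?powR_gt0//.
by rewrite ge0_ler_powR ?nnegrE ?oppr_ge0// ltW.
Qed.

Lemma ler_ppowR (p x y : R) : 0 <= p -> 0 <= x -> x <= y -> x `^ p <= y `^ p.
Proof.
by move=> p0 x0 xy; rewrite ge0_ler_powR ?nnegrE// (le_trans x0).
Qed.

Lemma powRN_mul (p x : R) : 0 < x -> x `^ (- p) * x `^ p = 1.
Proof. by move=> x0; rewrite powRN mulVf// gt_eqF// powR_gt0. Qed.

(** Indeed [(y / x)^h <= k^h <= k]; this bounds the ratios of powers below uniformly in n and h. *)
Lemma powR_ratio_le (h k x y : R) : 0 < h <= 1 -> 1 <= k -> 0 < x -> 0 <= y ->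
  y <= k * x -> y `^ h * x `^ (- h) <= k.
Proof.
move=> /andP[h0 h1] k1 x0 y0 yx; have k0 : 0 <= k := le_trans ler01 k1.
apply: (@le_trans _ _ ((k * x) `^ h * x `^ (- h))).
  by rewrite ler_wpM2r ?powR_ge0// ler_ppowR// ltW.
rewrite powRM ?(ltW x0)// -mulrA [x `^ h * _]mulrC (powRN_mul h x0) mulr1.
exact: ler1_powR.
Qed.

Lemma integral_itv_oocc (a b : R) (f : R -> R) : measurable_fun [set: R] f ->
  (\int[mu]_(x in `]a, b[) (f x)%:E = \int[mu]_(x in `[a, b]) (f x)%:E)%E.
Proof.
move=> mf; rewrite integral_itv_bndo_bndc ?integral_itv_obnd_cbnd//;
  by apply/measurable_EFinP; exact: measurable_funTS.
Qed.

(** Endpoints are null, so the comparison is confined to the open interval; this avoids the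
    conventional values of [powR] at base 0 with a negative exponent. *)
Lemma int_le_itv (a b C : R) (f g : R -> R) :
  measurable_fun [set: R] f -> measurable_fun [set: R] g ->
  (forall x, a < x < b -> 0 <= f x <= g x) ->
  int_le `[a, b] g C -> int_le `[a, b] f C.
Proof.
move=> mf mg fg; rewrite /int_le -!integral_itv_oocc//.
by apply: int_le_mono => //; exact: measurable_funTS.
Qed.

Lemma int_leZT D (f : R -> R) (C c : R) : measurable D ->
  measurable_fun [set: R] f -> (forall x, 0 <= f x) -> 0 <= c ->
  int_le D f C -> int_le D (fun x => c * f x) (c * C).
Proof. by move=> mD mf f0; apply: int_leZ => //; exact: measurable_funTS. Qed.

Lemma Rintegral_ge_itv (a b c C a' b' : R) (f : R -> R) :
  measurable_fun [set: R] f -> (forall x, 0 <= f x) ->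
  int_le `[a, b] f C -> a <= a' -> a' <= b' -> b' <= b -> 0 <= c ->
  (forall x, a' < x < b' -> c <= f x) ->
  c * (b' - a') <= \int[mu]_(x in `[a, b]) f x.
Proof.
move=> mf f0 fC aa ab bb c0 cf.
apply: (@Rintegral_ge R _ `]a', b'[%classic _ C) => //.
- exact: measurable_funTS.
- by move=> x /=; rewrite !in_itv/= => /andP[? ?]; apply/andP; split; lra.
- rewrite lebesgue_measure_itv/= lte_fin; case: ltP => [_|ba]; rewrite -?EFinB//.
  by congr (_%:E); lra.
Qed.

Lemma int_le_powR01 (c p : R) : 0 <= c -> -1 < p ->
  int_le `[0, 1] (fun x => c * x `^ p) (c * (p + 1)^-1).
Proof.
move=> c0 p1; apply: int_leZT => // [x|]; first exact: powR_ge0.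
by rewrite /int_le integral_powR01.
Qed.

(** With x = y + i - 1 and y in [0, 1] one has x >= i y, hence [x^(-h) <= i^(-h) y^(-h)], and
    [y^(-h)] integrates to 1 / (1 - h) <= 2. This covers the singular case i = 1 too. *)
Lemma int_le_powRN (h : R) (i : nat) : 0 < h < 1 / 2 -> (0 < i)%N ->
  int_le `[i%:R - 1, i%:R] (fun x => x `^ (- h)) (2 * i%:R `^ (- h)).
Proof.
move=> h0 i0; have i1 : 1 <= i%:R :> R by rewrite ler1n.
rewrite /int_le (@ge0_integral_affine R 1 (i%:R - 1) _ _ (oner_neq0 _)
  (measurable_itv _) (measurable_powR _) (fun x => powR_ge0 x _)).
rewrite normr1 mul1e (_ : _ @^-1` _ = `[0, 1]%classic); last first.
  by apply/seteqP; split=> x /=; rewrite !in_itv/= => /andP[? ?]; apply/andP; split; lra.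
have : int_le `[0, 1] (fun x => i%:R `^ (- h) * x `^ (- h)) (i%:R `^ (- h) * (- h + 1)^-1).
  by apply: int_le_powR01; rewrite ?powR_ge0//; lra.
move=> H; apply: (@le_trans _ _ (i%:R `^ (- h) * (- h + 1)^-1)%:E); last first.
  rewrite lee_fin mulrC ler_wpM2r ?powR_ge0//.
  by rewrite -[leRHS]invrK lef_pV2 ?posrE; lra.
apply: int_le_itv H.
- exact: (measurableT_comp (measurable_powR _) (measurable_affine _ _)).
- by apply: measurable_funM => //; exact: measurable_powR.
- move=> x /andP[x0 x1]; rewrite powR_ge0/= -powRM//; [|lra..].
  by apply: ler_npowR; [lra|apply: mulr_gt0; lra|nra].
Qed.

Definition Kint (h : R) (n : nat) (x : R) : R :=
  \int[mu]_(v in `[0, 1]) ((v + n%:R - 1) `^ h * (v + n%:R - 1 - x) `^ (h - 1)).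

Definition Jint (h : R) (n i : nat) : R :=
  \int[mu]_(x in `[(i%:R - 1), i%:R]) (x `^ (- h) * Kint h n x).

Definition Lint (h : R) (n : nat) (x : R) : R :=
  \int[mu]_(y in `[0, 1]) ((y * (n%:R - x) + x) `^ h * y `^ (h - 1)).

Definition Gint (h : R) (n : nat) : R :=
  \int[mu]_(x in `[(n%:R - 1), n%:R])
    (x `^ (- h) * (n%:R - x) `^ h * Lint h n x).

Lemma measurable_Kintegrand h (n : nat) (x : R) : measurable_fun [set: R]
  (fun v => (v + n%:R - 1) `^ h * (v + n%:R - 1 - x) `^ (h - 1)).
Proof.
by apply: measurable_funM; apply: (measurableT_comp (measurable_powR _));
  repeat (apply: measurable_funB => // || apply: measurable_funD => //).
Qed.

Lemma measurable_Kint h n : measurable_fun [set: R] (Kint h n).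
Proof.
apply: (@measurable_Rintegral_param R (fun z => (z.2 + n%:R - 1) `^ h *
  (z.2 + n%:R - 1 - z.1) `^ (h - 1))) => //; last first.
  by move=> z; rewrite mulr_ge0 ?powR_ge0.
by apply: measurable_funM; apply: (measurableT_comp (measurable_powR _));
  repeat (apply: measurable_funB => // || apply: measurable_funD => //).
Qed.

Lemma measurable_Jintegrand h n : measurable_fun [set: R]
  (fun x => x `^ (- h) * Kint h n x).
Proof. by apply: measurable_funM; [exact: measurable_powR|exact: measurable_Kint]. Qed.

Lemma Kint_ge0 h n x : 0 <= Kint h n x.
Proof. by apply: Rintegral_ge0 => v _; rewrite mulr_ge0 ?powR_ge0. Qed.

Lemma Jint_ge0 h n i : 0 <= Jint h n i.
Proof. by apply: Rintegral_ge0 => v _; rewrite mulr_ge0 ?powR_ge0 ?Kint_ge0. Qed.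

Lemma measurable_Lintegrand h (n : nat) (x : R) : measurable_fun [set: R]
  (fun y => (y * (n%:R - x) + x) `^ h * y `^ (h - 1)).
Proof.
apply: measurable_funM; apply: (measurableT_comp (measurable_powR _)) => //.
by apply: measurable_funD => //; apply: measurable_funM.
Qed.

Lemma measurable_Lint h n : measurable_fun [set: R] (Lint h n).
Proof.
apply: (@measurable_Rintegral_param R (fun z => (z.2 * (n%:R - z.1) + z.1) `^ h *
  z.2 `^ (h - 1))) => //; last first.
  by move=> z; rewrite mulr_ge0 ?powR_ge0.
apply: measurable_funM; apply: (measurableT_comp (measurable_powR _)) => //.
by apply: measurable_funD => //; apply: measurable_funM => //; apply: measurable_funB.
Qed.

Lemma measurable_Gintegrand h n : measurable_fun [set: R]
  (fun x => x `^ (- h) * (n%:R - x) `^ h * Lint h n x).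
Proof.
apply: measurable_funM; last exact: measurable_Lint.
apply: measurable_funM; first exact: measurable_powR.
by apply: (measurableT_comp (measurable_powR _)); apply: measurable_funB.
Qed.

Lemma Lint_ge0 h n x : 0 <= Lint h n x.
Proof. by apply: Rintegral_ge0 => v _; rewrite mulr_ge0 ?powR_ge0. Qed.

Lemma int_le_Kintegrand (h : R) (h0 : 0 < h < 1 / 2) n (x m : R) : 0 < m -> x <= n%:R - 1 - m -> 0 <= x ->
  int_le `[0, 1] (fun v => (v + n%:R - 1) `^ h * (v + n%:R - 1 - x) `^ (h - 1))
    (n%:R `^ h * m `^ (h - 1)).
Proof.
move=> m0 xn x0; have := @int_le_cst R 0 1 (n%:R `^ h * m `^ (h - 1)) ler01.
rewrite subr0 mulr1; apply: int_le_itv => //; first exact: measurable_Kintegrand.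
move=> v v01; rewrite mulr_ge0 ?powR_ge0//=; apply: ler_pM; rewrite ?powR_ge0//.
  by apply: ler_ppowR; lra.
by apply: ler_npowR; lra.
Qed.

(** The factor [x^(-h)] contributes [2 i^(-h)], and n = i + m + 1 <= 3 m i gives [n^h <= 3 m^h i^h].
    The powers of i cancel, leaving 6 = 2 * 3. *)
Lemma int_le_Jint (h : R) (h0 : 0 < h < 1 / 2) i m : (0 < i)%N -> (0 < m)%N ->
  int_le `[i%:R - 1, i%:R] (fun x => x `^ (- h) * Kint h (i + m).+1 x)
    (6 * m%:R `^ (2 * h - 1)).
Proof.
move=> i0 m0; set n := (i + m).+1.
have i1 : 1 <= i%:R :> R by rewrite ler1n.
have m1 : 1 <= m%:R :> R by rewrite ler1n.
have nE : n%:R = i%:R + m%:R + 1 :> R by rewrite /n -addn1 !natrD.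
have := int_leZT (measurable_itv _) (measurable_powR (- h)) (fun x => powR_ge0 x (- h))
  (_ : 0 <= n%:R `^ h * m%:R `^ (h - 1)) (int_le_powRN h0 i0).
move=> /(_ (mulr_ge0 (powR_ge0 _ _) (powR_ge0 _ _))) H.
have {}H : int_le `[i%:R - 1, i%:R] (fun x => x `^ (- h) * Kint h n x)
    (n%:R `^ h * m%:R `^ (h - 1) * (2 * i%:R `^ (- h))).
  apply: int_le_itv H.
  - exact: measurable_Jintegrand.
  - by apply: measurable_funM => //; exact: measurable_powR.
  - move=> x /andP[x0 x1]; rewrite mulr_ge0 ?powR_ge0 ?Kint_ge0//= mulrC.
    rewrite ler_wpM2r ?powR_ge0//; apply: Rintegral_le => [v _|].
      by rewrite mulr_ge0 ?powR_ge0.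
    by apply: int_le_Kintegrand; lra.
apply: (le_trans H); rewrite lee_fin.
have n3 : n%:R `^ h <= 3 * (m%:R `^ h * i%:R `^ h).
  apply: (@le_trans _ _ ((3 * (m%:R * i%:R)) `^ h)).
    by apply: ler_ppowR; [lra|lra|nra].
  rewrite !powRM ?mulr_ge0//; rewrite ler_wpM2r ?mulr_ge0 ?powR_ge0//.
  by apply: ler1_powR; lra.
have mE : m%:R `^ (2 * h - 1) = m%:R `^ h * m%:R `^ (h - 1).
  rewrite -powRD; last by apply/implyP => _; rewrite gt_eqF; lra.
  by congr (_ `^ _); ring.
rewrite mE; have := powRN_mul h (lt_le_trans ltr01 i1).
have := powR_ge0 m%:R (h - 1); have := powR_ge0 (i%:R : R) (- h).
move: n3; set A := n%:R `^ h; set B := m%:R `^ h; set I := i%:R `^ h.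
set M := m%:R `^ (h - 1); set J := i%:R `^ (- h) => n3 J0 M0 JI.
apply: (@le_trans _ _ (3 * (B * I) * M * (2 * J))).
  by rewrite ler_wpM2r ?mulr_ge0// ler_wpM2r.
rewrite (_ : 3 * (B * I) * M * (2 * J) = 6 * (B * M) * (J * I)); last by ring.
by rewrite JI mulr1.
Qed.

Lemma Jint_le (h : R) (h0 : 0 < h < 1 / 2) i m : (0 < i)%N -> (0 < m)%N ->
  Jint h (i + m).+1 i <= 6 * m%:R `^ (2 * h - 1).
Proof.
move=> i0 m0; apply: Rintegral_le (int_le_Jint h0 i0 m0) => x _.
by rewrite mulr_ge0 ?powR_ge0 ?Kint_ge0.
Qed.

(** As x <= n - 1 <= v + n - 1, the factors with exponents -h and h multiply to at least 1. The
    remaining base is at most m + 2 = n - i + 1, and h - 1 >= -1. *)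
Lemma Jint_ge (h : R) (h0 : 0 < h < 1 / 2) i m : (1 < i)%N -> (0 < m)%N ->
  (m.+2)%:R^-1 <= Jint h (i + m).+1 i.
Proof.
move=> i0 m0; set n := (i + m).+1.
have i1 : 2 <= i%:R :> R by rewrite ler_nat.
have m1 : 1 <= m%:R :> R by rewrite ler1n.
have nE : n%:R = i%:R + m%:R + 1 :> R by rewrite /n -addn1 !natrD.
have mE : m.+2%:R = m%:R + 2 :> R by rewrite -addn2 natrD.
have := int_le_Jint h0 (ltnW i0) m0; rewrite -/n; move: n nE => n nE nJ.
have := @Rintegral_ge_itv (i%:R - 1) i%:R (m.+2%:R^-1) _ (i%:R - 1) i%:R _
  (measurable_Jintegrand h n) _ nJ.
rewrite (_ : i%:R - (i%:R - 1) = 1) ?mulr1; last by ring.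
apply; rewrite ?invr_ge0//; [|lra..|].
  by move=> x; rewrite mulr_ge0 ?powR_ge0 ?Kint_ge0.
move=> x /andP[x0 x1].
apply: (@le_trans _ _ ((n%:R - 1) `^ (- h) * ((n%:R - 1) `^ h * m.+2%:R `^ (h - 1)))).
  rewrite mulrA powRN_mul ?mul1r; last by lra.
  rewrite -powR_inv1; last by lra.
  by apply: ler_powR; lra.
apply: ler_pM; rewrite ?mulr_ge0 ?powR_ge0//; first by apply: ler_npowR; lra.
have := @Rintegral_ge_itv 0 1 ((n%:R - 1) `^ h * m.+2%:R `^ (h - 1)) _ 0 1 _
  (measurable_Kintegrand h n x) _ (@int_le_Kintegrand h h0 n x m%:R _ _ _).
rewrite subr0 mulr1; apply; rewrite ?mulr_ge0 ?powR_ge0//; [|lra..|].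
  by move=> v; rewrite mulr_ge0 ?powR_ge0.
move=> v /andP[v0 v1]; apply: ler_pM; rewrite ?powR_ge0//.
  by apply: ler_ppowR; lra.
by apply: ler_npowR; lra.
Qed.

(* Near the diagonal the kernel (v + r)^(h - 1), with r = n - 1 - x, is bounded by
   v^(-1/2) r^(h - 1/2); unlike the bound v^(h - 1), whose integral is 1/h, this
   one stays bounded as h tends to 0. *)
Lemma Jint_diag_le (h : R) (h0 : 0 < h < 1 / 2) n : (2 < n)%N -> Jint h n n.-1 <= 12.
Proof.
case: n => [//|[//|[//|k]]] _; set n := k.+3; rewrite /=.
have nE : n%:R = k%:R + 3 :> R by rewrite /n -addn3 natrD.
have iE : k.+2%:R = n%:R - 1 :> R by rewrite nE -addn2 natrD; ring.
have k0 : 0 <= k%:R :> R by [].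
apply: Rintegral_le => [x _|]; first by rewrite mulr_ge0 ?powR_ge0 ?Kint_ge0.
(* The 2 is the integral of [v^(-1/2)]; the ratio of powers is at most 3 since n <= 3 (n - 2).
   Integrating [r^(h - 1/2)] gives another factor 2, hence 12. *)
rewrite -/n iE; pose c := 2 * (n%:R `^ h * (n%:R - 2) `^ (- h)).
have c0 : 0 <= c by rewrite !mulr_ge0 ?powR_ge0.
have mr : measurable_fun [set: R] (fun x => (n%:R - 1 - x) `^ (h - 1 / 2)).
  by apply: (measurableT_comp (measurable_powR _)); apply: measurable_funB.
have c6 : c <= 6.
  rewrite /c; suff : n%:R `^ h * (n%:R - 2) `^ (- h) <= 3 by move=> ?; lra.
  by apply: powR_ratio_le; rewrite ?nE; lra.
have : int_le `[n%:R - 1 - 1, n%:R - 1] (fun x => c * (n%:R - 1 - x) `^ (h - 1 / 2)) (c * 2).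
  apply: int_leZT => // [x|]; first exact: powR_ge0.
  rewrite /int_le (@ge0_integral_affine R (-1) (n%:R - 1)) ?oppr_eq0 ?oner_eq0//;
    last by move=> x; exact: powR_ge0.
  rewrite normrN normr1 mul1e (_ : _ @^-1` _ = `[0, 1]%classic); last first.
      by apply/seteqP; split=> x /=; rewrite !in_itv/= => /andP[? ?]; apply/andP; split; lra.
  under eq_integral do rewrite mulN1r opprD opprK addrCA subrr addr0.
  rewrite integral_powR01 ?lee_fin; last by lra.
  by rewrite -[leRHS]invrK lef_pV2 ?posrE; lra.
move=> H; rewrite /int_le; apply: (@le_trans _ _ (c * 2)%:E); last by rewrite lee_fin; lra.
apply: int_le_itv H.
- exact: measurable_Jintegrand.
- exact: measurable_funM.
- move=> x /andP[x0 x1]; rewrite mulr_ge0 ?powR_ge0 ?Kint_ge0//=.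
  rewrite /c (_ : 2 * _ * _ = (n%:R - 2) `^ (- h) *
    (n%:R `^ h * (n%:R - 1 - x) `^ (h - 1 / 2) * 2)); last by ring.
  apply: ler_pM; rewrite ?powR_ge0 ?Kint_ge0//; first by apply: ler_npowR; lra.
  apply: Rintegral_le => [v _|]; first by rewrite mulr_ge0 ?powR_ge0.
  have : int_le `[0, 1] (fun v => n%:R `^ h * (n%:R - 1 - x) `^ (h - 1 / 2) * v `^ (- (1 / 2)))
    (n%:R `^ h * (n%:R - 1 - x) `^ (h - 1 / 2) * (- (1 / 2) + 1)^-1).
    by apply: int_le_powR01; rewrite ?mulr_ge0 ?powR_ge0//; lra.
  rewrite (_ : (- (1 / 2) + 1)^-1 = 2 :> R); last by field.
  apply: int_le_itv; first exact: measurable_Kintegrand.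
    by apply: measurable_funM => //; exact: measurable_powR.
  move=> v /andP[v0 v1]; rewrite mulr_ge0 ?powR_ge0//= -mulrA.
  apply: ler_pM; rewrite ?powR_ge0//; first by apply: ler_ppowR; lra.
  rewrite (_ : h - 1 = (h - 1 / 2) + - (1 / 2)); last by field.
  rewrite powRD; last by apply/implyP => _; rewrite gt_eqF; lra.
  by apply: ler_pM; rewrite ?powR_ge0//; apply: ler_npowR; lra.
Qed.

Lemma int_le_Lintegrand (h : R) (h0 : 0 < h < 1 / 2) n x : n%:R - 1 < x < n%:R -> 0 <= x ->
  int_le `[0, 1] (fun y => (y * (n%:R - x) + x) `^ h * y `^ (h - 1)) (n%:R `^ h * h^-1).
Proof.
move=> xn x0.
have : int_le `[0, 1] (fun y => n%:R `^ h * y `^ (h - 1)) (n%:R `^ h * (h - 1 + 1)^-1).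
  by apply: int_le_powR01; rewrite ?powR_ge0//; lra.
rewrite subrK; apply: int_le_itv; first exact: measurable_Lintegrand.
  by apply: measurable_funM => //; exact: measurable_powR.
move=> y y01; rewrite mulr_ge0 ?powR_ge0//= ler_wpM2r ?powR_ge0//.
by apply: ler_ppowR; [lra|nra|nra].
Qed.

(** The singular factor [y^(h - 1)] in [Lint] gives 1 / h; the other powers are at most
    [(n / (n - 1))^h <= 2]. *)
Lemma int_le_Gint (h : R) (h0 : 0 < h < 1 / 2) n : (1 < n)%N ->
  int_le `[n%:R - 1, n%:R] (fun x => x `^ (- h) * (n%:R - x) `^ h * Lint h n x) (2 * h^-1).
Proof.
move=> n1; have n2 : 2 <= n%:R :> R by rewrite ler_nat.
have := @int_le_cst R (n%:R - 1) n%:R (2 * h^-1) ltac:(lra).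
rewrite (_ : n%:R - (n%:R - 1) = 1) ?mulr1; last by ring.
apply: int_le_itv => //; first exact: measurable_Gintegrand.
move=> x xn; rewrite !mulr_ge0 ?powR_ge0 ?Lint_ge0//=.
have LB : Lint h n x <= n%:R `^ h * h^-1.
  apply: Rintegral_le => [v _|]; first by rewrite mulr_ge0 ?powR_ge0.
  by apply: int_le_Lintegrand; lra.
apply: (@le_trans _ _ ((n%:R - 1) `^ (- h) * 1 * (n%:R `^ h * h^-1))).
  apply: ler_pM; rewrite ?mulr_ge0 ?powR_ge0 ?Lint_ge0//.
  apply: ler_pM; rewrite ?powR_ge0//; first by apply: ler_npowR; lra.
  apply: (@le_trans _ _ (1 `^ h)); last by rewrite powR1.
  by apply: ler_ppowR; lra.
rewrite mulr1 mulrA ler_wpM2r ?invr_ge0//; first by lra.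
by rewrite mulrC; apply: powR_ratio_le; lra.
Qed.

Lemma Gint_le (h : R) (h0 : 0 < h < 1 / 2) n : (1 < n)%N -> Gint h n <= 2 * h^-1.
Proof.
move=> n1; apply: Rintegral_le (int_le_Gint h0 n1) => x _.
by rewrite !mulr_ge0 ?powR_ge0 ?Lint_ge0.
Qed.

(** Comparison with [x^h y^(h - 1)] on all of ]0, 1[: a constant lower bound on a fixed subinterval
    would lose the factor 1 / h. *)
Lemma Lint_ge (h : R) (h0 : 0 < h < 1 / 2) n x : n%:R - 1 < x < n%:R -> 0 < x -> x `^ h * h^-1 <= Lint h n x.
Proof.
move=> xn x0.
have h1 : \int[mu]_(y in `[0, 1]) y `^ (h - 1) = h^-1.
  by rewrite /Rintegral integral_powR01 ?subrK//; lra.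
rewrite -h1 -(@ge0_RintegralZl R _ (fun y => y `^ (h - 1)) (x `^ h) (measurable_itv _)
  (measurable_funTS (measurable_powR _)) (fun y _ => powR_ge0 y _) (powR_ge0 _ _)).
have mx : measurable_fun [set: R] (fun y => x `^ h * y `^ (h - 1)).
  by apply: measurable_funM => //; exact: measurable_powR.
have mL := measurable_Lintegrand h n x.
apply: fine_le.
- apply: integral_ge0_fin => [y _|]; first by rewrite mulr_ge0 ?powR_ge0.
  by apply: (int_le_powR01 (p := h - 1)); rewrite ?powR_ge0//; lra.
- apply: integral_ge0_fin => [y _|]; first by rewrite mulr_ge0 ?powR_ge0.
  by apply: int_le_Lintegrand; lra.
rewrite -(integral_itv_oocc _ _ mx) -(integral_itv_oocc _ _ mL).
apply: ge0_le_integral => //.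
- by move=> y _; rewrite lee_fin mulr_ge0 ?powR_ge0.
- by apply/measurable_EFinP; exact: measurable_funTS.
- by apply/measurable_EFinP; exact: measurable_funTS.
- move=> y /=; rewrite in_itv/= lee_fin => y01; rewrite ler_wpM2r ?powR_ge0//.
  by apply: ler_ppowR; [lra|lra|nra].
Qed.

Lemma Gint_ge (h : R) (h0 : 0 < h < 1 / 2) n : (1 < n)%N -> (4 * h)^-1 <= Gint h n.
Proof.
move=> n1; have n2 : 2 <= n%:R :> R by rewrite ler_nat.
have hV : 0 < h^-1 by rewrite invr_gt0; lra.
(* On the left half of the interval n - x >= 1/2, so [(n - x)^h >= 1/2]. Together with the length
   1/2 and [Lint_ge] this gives 1 / (4 h). *)
have := @Rintegral_ge_itv (n%:R - 1) n%:R (2^-1 * h^-1) _ (n%:R - 1) (n%:R - 1 / 2) _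
  (measurable_Gintegrand h n) _ (int_le_Gint h0 n1).
rewrite (_ : 2^-1 * h^-1 * _ = (4 * h)^-1); last by field; lra.
apply; [|lra..| |].
- by move=> x; rewrite !mulr_ge0 ?powR_ge0 ?Lint_ge0.
- by rewrite mulr_ge0// ltW.
move=> x /andP[x0 x1].
apply: (@le_trans _ _ (x `^ (- h) * 2^-1 * (x `^ h * h^-1))).
  rewrite (_ : x `^ (- h) * _ * _ = (x `^ (- h) * x `^ h) * (2^-1 * h^-1)); last by ring.
  by rewrite powRN_mul ?mul1r//; lra.
apply: ler_pM; rewrite ?mulr_ge0 ?powR_ge0 ?(ltW hV)//; last by apply: Lint_ge; lra.
rewrite ler_wpM2l ?powR_ge0//; apply: (@le_trans _ _ (2^-1 `^ h)).
  by apply: ger1_powR; lra.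
by apply: ler_ppowR; lra.
Qed.

End kernel_bounds.

(** * Positivity of the normalizing constant and scaling of the kernel *)

Section scaling.
Context {R : realType}.
Notation mu := (@lebesgue_measure R).

(** Finiteness comes first, since [Gamma] is a real-valued integral: the integrand is below
    [t^(z - 1)] on ]0, 1] and below four times the exponential density of rate 1/2 beyond 1.
    Positivity is then read off on ]1, 2[. *)
Lemma Gamma_gt0 (z : R) : 0 < z <= 2 -> 0 < Gamma z.
Proof.
move=> z02; set D := `]0, +oo[%classic : set R.
have mD : measurable D by exact: measurable_itv.
pose f (t : R) := t `^ (z - 1) * expR (- t).
have mf : measurable_fun [set: R] f.
  apply: measurable_funM; first exact: measurable_powR.
  by apply: measurableT_comp => //; exact: measurable_funN.
have f0 t : 0 <= f t by rewrite mulr_ge0 ?powR_ge0 ?expR_ge0.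
pose g1 (t : R) := t `^ (z - 1) * \1_(`[0, 1]%classic) t.
pose g2 (t : R) := 4 * exponential_pdf (2^-1) t.
have mg1 : measurable_fun [set: R] g1.
  by apply: measurable_funM; [exact: measurable_powR|exact: measurable_indic].
have mg2 : measurable_fun [set: R] g2.
  by apply: measurable_funM => //; exact: measurable_exponential_pdf.
have g10 t : 0 <= g1 t by rewrite mulr_ge0 ?powR_ge0.
have g20 t : 0 <= g2 t by rewrite mulr_ge0// exponential_pdf_ge0.
have fg t : D t -> 0 <= f t <= g1 t + g2 t.
  rewrite /D/= in_itv/= andbT => t0; rewrite f0/=.
  have [t1|t1] := leP t 1.
    have tin : t \in (`[0, 1]%classic : set R) by rewrite inE/= in_itv/= t1 ltW.
    rewrite -[leLHS]addr0 lerD// /g1 indicE tin.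
    by rewrite ler_wpM2l ?powR_ge0// -[leRHS]expR0 ler_expR; lra.
  rewrite -[leLHS]add0r lerD// /g2 exponential_pdfE; last by rewrite ltW// (lt_trans ltr01).
  apply: (@le_trans _ _ (t * expR (- t))).
    rewrite ler_wpM2r ?expR_ge0//.
    apply: (@le_trans _ _ (t `^ 1)); last by rewrite powRr1 ?(ltW t0).
    by apply: ler_powR; lra.
  (* Half of the exponential absorbs the factor t, as [t <= 2 e^(t/2)]. *)
  have -> : - t = - 2^-1 * t + - (2^-1 * t) by field.
  rewrite expRD mulrCA [leRHS](_ : _ = expR (- 2^-1 * t) * 2); last by field.
  rewrite ler_wpM2l ?expR_ge0// expRN ler_pdivrMr ?expR_gt0//.
  by have := expR_ge1Dx (2^-1 * t); lra.
have fC : int_le D f (z^-1 + 4).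
  apply: (@int_le_mono R D f (fun t => g1 t + g2 t)) => //.
  - exact: measurable_funTS.
  - by apply: measurable_funTS; exact: measurable_funD.
  rewrite /int_le.
  apply: (@le_trans _ _ (\int[mu]_t ((g1 t)%:E + (g2 t)%:E))%E).
    apply: ge0_subset_integral => //.
    + by apply/measurable_EFinP; exact: measurable_funD.
    + by move=> t _; rewrite lee_fin addr_ge0.
  rewrite ge0_integralD//; last 4 first.
  - by move=> t _; rewrite lee_fin.
  - exact/measurable_EFinP.
  - by move=> t _; rewrite lee_fin.
  - exact/measurable_EFinP.
  rewrite EFinD; apply: leeD.
    rewrite (_ : (\int[mu]_t _)%E = (\int[mu]_(t in `[0%R, 1%R]) (t `^ (z - 1))%:E)%E).
      by rewrite integral_powR01 ?subrK//; lra.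
    rewrite [RHS]integral_mkcond; apply: eq_integral => t _.
    by rewrite /g1 patchE indicE; case: (t \in _); rewrite ?mulr1 ?mulr0.
  under eq_integral do rewrite EFinM.
  rewrite ge0_integralZl//.
  - by rewrite integral_exponential_pdf ?mule1// invr_gt0.
  - by apply/measurable_EFinP; exact: measurable_exponential_pdf.
  - by move=> t _; rewrite lee_fin exponential_pdf_ge0.
apply: (@lt_le_trans _ _ (2^-1 * expR (-2) * 1)).
  by rewrite mulr1 mulr_gt0 ?expR_gt0// invr_gt0.
apply: (@Rintegral_ge R D `]1, 2[%classic f (z^-1 + 4)) => //.
- exact: measurable_funTS.
- by move=> t /=; rewrite /D/= !in_itv/= => /andP[? ?]; rewrite andbT; lra.
- rewrite lebesgue_measure_itv/= lte_fin ifT; last by lra.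
  by rewrite -EFinB; congr (_%:E); lra.
move=> t /=; rewrite in_itv/= => /andP[t1 t2]; apply: ler_pM; rewrite ?expR_ge0 ?invr_ge0//.
  apply: (@le_trans _ _ (t `^ (-1))); last by apply: ler_powR; lra.
  by rewrite powR_inv1 ?lef_pV2 ?posrE; lra.
by rewrite ler_expR; lra.
Qed.

Lemma C_H_gt0 (H : R) : 1 / 2 < H < 1 -> 0 < C_H H.
Proof.
move=> H01; rewrite mulr_gt0//; last by lra.
rewrite sqrtr_gt0 divr_gt0// mulr_gt0 ?Gamma_gt0//; lra.
Qed.

Lemma exponentN (H : R) : 1 / 2 - H = - (H - 1 / 2).
Proof. by rewrite opprB. Qed.

Lemma exponentB1 (H : R) : H - 3 / 2 = H - 1 / 2 - 1.
Proof. by field. Qed.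

Lemma jHE (sigma H : R) n i : jH sigma H n i = sigma * C_H H * Jint (H - 1 / 2) n i.
Proof. by rewrite /jH /Jint /Kint exponentN exponentB1. Qed.

Lemma gHE (sigma H : R) n : gH sigma H n = sigma * C_H H * Gint (H - 1 / 2) n.
Proof. by rewrite /gH /Gint /Lint exponentN exponentB1. Qed.

Section fractional_kernel.
Variable h : R.

(** The integral in [kH] is the case a = u. The interval is kept separate from u so that an
    increment of [kH] in t is again of this form. *)
Definition Fint (a b u : R) : R :=
  \int[mu]_(w in `[a, b]) (w `^ h * (w - u) `^ (h - 1)).

Lemma measurable_Fintegrand u :
  measurable_fun [set: R] (fun w => w `^ h * (w - u) `^ (h - 1)).
Proof.
apply: measurable_funM; first exact: measurable_powR.
by apply: (measurableT_comp (measurable_powR _)); exact: measurable_funB.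
Qed.

Lemma Fintegrand_ge0 u (w : R) : 0 <= w `^ h * (w - u) `^ (h - 1).
Proof. by rewrite mulr_ge0 ?powR_ge0. Qed.

Lemma Fint_affine (a b c d u : R) : 0 < c ->
  Fint (c * a + d) (c * b + d) u =
  c * \int[mu]_(y in `[a, b]) ((c * y + d) `^ h * (c * y + d - u) `^ (h - 1)).
Proof.
move=> c0; rewrite /Fint Rintegral_affine//; first exact: measurable_Fintegrand.
exact: Fintegrand_ge0.
Qed.

Lemma Fintegrand_integrable (u t : R) : 0 < h < 1 / 2 -> 0 <= u -> u < t ->
  mu.-integrable `[u, t] (EFin \o (fun w => w `^ h * (w - u) `^ (h - 1))).
Proof.
move=> h01 u0 ut; have c0 : 0 < t - u by lra.
have mp : measurable_fun [set: R] (fun w => t `^ h * (w - u) `^ (h - 1)).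
  apply: measurable_funM => //.
  by apply: (measurableT_comp (measurable_powR _)); exact: measurable_funB.
apply: (@integrable_int_le R _ _ (`|t - u| * (t `^ h * (t - u) `^ (h - 1) * (h - 1 + 1)^-1))) => //.
- by apply: measurable_funTS; exact: measurable_Fintegrand.
- by move=> w _; exact: Fintegrand_ge0.
apply: (@int_le_itv R u t _ _ (fun w => t `^ h * (w - u) `^ (h - 1))) => //.
- exact: measurable_Fintegrand.
- move=> w /andP[uw wt]; rewrite Fintegrand_ge0/= ler_wpM2r ?powR_ge0//.
  by apply: ler_ppowR; lra.
rewrite /int_le (@ge0_integral_affine R (t - u) u)//; last 2 first.
- by rewrite gt_eqF.
- by move=> w; rewrite mulr_ge0 ?powR_ge0.
rewrite EFinM lee_wpmul2l ?lee_fin//.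
rewrite (_ : _ @^-1` _ = `[0, 1]%classic); last first.
  apply/seteqP; split=> x /=; rewrite !in_itv/= => /andP[? ?]; apply/andP; split; nra.
rewrite (_ : (\int[mu]_(x in _) _)%E = (\int[mu]_(y in `[0%R, 1%R])
    (t `^ h * (t - u) `^ (h - 1) * y `^ (h - 1))%:E)%E).
  by apply: (int_le_powR01 (p := h - 1)); rewrite ?mulr_ge0 ?powR_ge0//; lra.
apply: eq_integral => y /[!inE]/=; rewrite in_itv/= => /andP[y0 y1].
by rewrite addrK powRM ?mulrA// ltW.
Qed.

Lemma FintB (u s t : R) : 0 < h < 1 / 2 -> 0 <= u -> u <= s -> s < t ->
  Fint u t u - Fint u s u = Fint s t u.
Proof.
move=> h01 u0 us st; have ut := le_lt_trans us st.
have it := Fintegrand_integrable h01 u0 ut.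
rewrite /Fint Rintegral_itvB ?bnd_simp//; last exact: ltW.
apply: Rintegral_itv_obnd_cbnd; apply: integrableS it => //.
by move=> x /=; rewrite !in_itv/= => /andP[? ?]; apply/andP; split; lra.
Qed.

(** Substitute w = delta (v + n - 1): the powers 1, h and h - 1 of delta add up to 2 h. *)
Lemma Fint_block (delta x : R) (n : nat) : 0 < delta -> 0 <= x -> x <= n%:R - 1 ->
  Fint (delta * (n%:R - 1)) (delta * n%:R) (delta * x) =
  delta `^ (2 * h) * Kint h n x.
Proof.
move=> d0 x0 xn.
have := Fint_affine 0 1 (delta * (n%:R - 1)) (delta * x) d0.
rewrite mulr0 add0r mulr1 (_ : delta + delta * (n%:R - 1) = delta * n%:R); last by ring.
move=> ->.
rewrite (@eq_Rintegral _ _ _ mu _ (fun v => delta `^ (h + (h - 1)) *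
    ((v + n%:R - 1) `^ h * (v + n%:R - 1 - x) `^ (h - 1)))); last first.
  move=> v /[!inE]/=; rewrite in_itv/= => /andP[v0 v1].
  rewrite -mulrDr -mulrBr addrA !powRM; [|lra..].
  rewrite (@powRD _ delta h (h - 1)); last by apply/implyP => _; rewrite gt_eqF.
  by ring.
rewrite ge0_RintegralZl ?powR_ge0//; last 2 first.
- by apply: measurable_funTS; exact: measurable_Kintegrand.
- by move=> v _; rewrite mulr_ge0 ?powR_ge0.
rewrite mulrA; congr (_ * _); rewrite -[X in X * _](@powRr1 R delta) ?(ltW d0)//.
rewrite -powRD; last by apply/implyP => _; rewrite gt_eqF.
by congr (_ `^ _); ring.
Qed.

(** Substitute w = delta ((n - x) y + x), so that the singular base becomes delta (n - x) y. At x =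
    n both sides vanish. *)
Lemma Fint_last (delta x : R) (n : nat) : 0 < h < 1 / 2 -> 0 < delta -> 0 <= x -> x <= n%:R ->
  Fint (delta * x) (delta * n%:R) (delta * x) =
  delta `^ (2 * h) * ((n%:R - x) `^ h * Lint h n x).
Proof.
move=> h01 d0 x0; rewrite le_eqVlt => /predU1P[->|xn].
  rewrite subrr powR0 ?mul0r ?mulr0 /Fint ?set_itv1 ?Rintegral_set1//.
  by apply/eqP; lra.
pose c := delta * (n%:R - x); have c0 : 0 < c by rewrite mulr_gt0// subr_gt0.
have := Fint_affine 0 1 (delta * x) (delta * x) c0.
rewrite mulr0 add0r mulr1 (_ : c + delta * x = delta * n%:R); last by rewrite /c; ring.
move=> ->.
rewrite (@eq_Rintegral _ _ _ mu _ (fun y => delta `^ h * c `^ (h - 1) *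
    ((y * (n%:R - x) + x) `^ h * y `^ (h - 1)))); last first.
  move=> y /[!inE]/=; rewrite in_itv/= => /andP[y0 y1]; rewrite addrK.
  have -> : c * y + delta * x = delta * (y * (n%:R - x) + x) by rewrite /c; ring.
  rewrite powRM; [|lra|nra]; rewrite powRM; [|lra|lra].
  by ring.
rewrite ge0_RintegralZl ?mulr_ge0 ?powR_ge0//; last 2 first.
- by apply: measurable_funTS; exact: measurable_Lintegrand.
- by move=> v _; rewrite mulr_ge0 ?powR_ge0.
rewrite -/(Lint h n x) mulrA [RHS]mulrA; congr (_ * _).
rewrite mulrCA -[X in _ * (X * _)](@powRr1 R c) ?(ltW c0)//.
rewrite -powRD; last by apply/implyP => _; rewrite gt_eqF.
rewrite (_ : 1 + (h - 1) = h); last by ring.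
rewrite /c powRM; [|lra..]; rewrite mulrA -powRD; last by apply/implyP => _; rewrite gt_eqF.
by congr (_ `^ _ * _); ring.
Qed.

End fractional_kernel.

(** Put u = x / N and h = H - 1/2. The exponents of N are 1/2 from the square root, -1 from du, h
    from [u^(-h)] and -2 h from the inner integral; their sum is -H. *)
Lemma scaled_integral (H sigma : R) (N : nat) (a b : R) (f Phi : R -> R) :
  1 / 2 < H < 1 -> (0 < N)%N -> 0 <= a ->
  measurable_fun [set: R] Phi -> (forall x, 0 <= Phi x) ->
  (forall x, a <= x <= b ->
     f (N%:R^-1 * x) = C_H H * (N%:R^-1 * x) `^ (- (H - 1 / 2)) *
       (N%:R^-1 `^ (2 * (H - 1 / 2)) * Phi x)) ->
  sigma * Num.sqrt N%:R * \int[mu]_(u in `[a / N%:R, b / N%:R]) f u =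
  N%:R `^ (- H) * (sigma * C_H H * \int[mu]_(x in `[a, b]) (x `^ (- (H - 1 / 2)) * Phi x)).
Proof.
move=> H01 N0 a0 mPhi Phi0 fE; set h := H - 1 / 2.
have Np : 0 < N%:R :> R by rewrite ltr0n.
pose delta : R := N%:R^-1; have d0 : 0 < delta by rewrite invr_gt0.
have C0 := C_H_gt0 H01.
(* f is prescribed on the interval only; F agrees with it there and is measurable and nonnegative
   everywhere, as the change of variables requires. *)
pose F u := C_H H * (u `^ (- h) * (delta `^ (2 * h) * Phi (N%:R * u + 0))).
have mF : measurable_fun [set: R] F.
  apply: measurable_funM => //; apply: measurable_funM; first exact: measurable_powR.
  by apply: measurable_funM => //; apply: (measurableT_comp mPhi); exact: measurable_affine.
have F0 u : 0 <= F u.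
  by apply: mulr_ge0; [exact: ltW|apply: mulr_ge0; rewrite ?mulr_ge0 ?powR_ge0].
rewrite (@eq_Rintegral _ _ _ mu _ F); last first.
  move=> u /[!inE]/=; rewrite in_itv/= ler_pdivrMr// ler_pdivlMr// => uab.
  have := fE (u * N%:R) uab; rewrite mulrCA mulVf ?gt_eqF// mulr1 => ->.
  by rewrite /F addr0 (mulrC u) -mulrA.
have -> : a / N%:R = delta * a + 0 by rewrite addr0 mulrC.
have -> : b / N%:R = delta * b + 0 by rewrite addr0 mulrC.
rewrite Rintegral_affine//.
rewrite (@eq_Rintegral _ _ _ mu _ (fun x => C_H H * delta `^ (- h) * delta `^ (2 * h) *
   (x `^ (- h) * Phi x))); last first.
  move=> x /[!inE]/=; rewrite in_itv/= => /andP[ax xb].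
  rewrite /F !addr0 [N%:R * _]mulrA mulfV ?gt_eqF// mul1r powRM ?(ltW d0) ?(le_trans a0)//.
  by ring.
have mI : measurable_fun `[a, b] (fun x => x `^ (- h) * Phi x).
  by apply: measurable_funTS; apply: measurable_funM => //; exact: measurable_powR.
have I0 x : 0 <= x `^ (- h) * Phi x by rewrite mulr_ge0 ?powR_ge0.
rewrite (ge0_RintegralZl (measurable_itv _) mI (fun x _ => I0 x)); last first.
  by rewrite mulr_ge0 ?powR_ge0// mulr_ge0 ?powR_ge0// ltW.
set I := \int[mu]_(x in _) _.
have -> : N%:R `^ (- H) = N%:R `^ 2^-1 * delta `^ 1 * delta `^ (- h) * delta `^ (2 * h) :> R.
  have dE p : delta `^ p = N%:R `^ (- p).
    by rewrite -mulN1r powRrM powR_inv1 ?(ltW Np).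
  rewrite !dE -!powRD; try by apply/implyP => _; rewrite gt_eqF.
  by congr (_ `^ _); rewrite /h; field.
rewrite powR12_sqrt ?(ltW Np)// powRr1 ?(ltW d0)//.
by ring.
Qed.

End scaling.

(** * Market coefficients rescaled, and asymptotics of the array *)

Section coefficients.
Context {R : realType}.
Notation mu := (@lebesgue_measure R).

Lemma kHE (H t s : R) :
  kH H t s = C_H H * s `^ (- (H - 1 / 2)) * Fint (H - 1 / 2) s t s.
Proof. by rewrite /kH /Fint exponentN exponentB1. Qed.

Lemma JNE (sigma H : R) (N n i : nat) : 1 / 2 < H < 1 -> (0 < N)%N -> (0 < i < n)%N ->
  JN sigma H N n i = N%:R `^ (- H) * jH sigma H n i.
Proof.
move=> H01 N0 /andP[i0 lein]; have h01 : 0 < H - 1 / 2 < 1 / 2 by lra.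
have d0 : 0 < N%:R^-1 :> R by rewrite invr_gt0 ltr0n.
have i1 : 1 <= i%:R :> R by rewrite ler1n.
have in1 : i%:R + 1 <= n%:R :> R by rewrite natr1 ler_nat.
rewrite jHE /JN /Jint; apply: scaled_integral => //; first by lra.
- exact: measurable_Kint.
- exact: Kint_ge0.
move=> x /andP[x1 x2]; rewrite !kHE -mulrBr; congr (_ * _).
rewrite -Fint_block//; [|lra..].
rewrite [n%:R / _]mulrC [(n%:R - 1) / _]mulrC.
by apply: FintB => //; [apply: mulr_ge0; [exact: ltW|lra]|rewrite ler_pM2l//; lra|rewrite ltr_pM2l//; lra].
Qed.

Lemma gNE (sigma H : R) (N n : nat) : 1 / 2 < H < 1 -> (0 < N)%N -> (0 < n)%N ->
  gN sigma H N n = N%:R `^ (- H) * gH sigma H n.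
Proof.
move=> H01 N0 n0; have h01 : 0 < H - 1 / 2 < 1 / 2 by lra.
have d0 : 0 < N%:R^-1 :> R by rewrite invr_gt0 ltr0n.
have n1 : 1 <= n%:R :> R by rewrite ler1n.
rewrite gHE /gN /Gint.
rewrite (@scaled_integral R H sigma N _ _ _ (fun x => (n%:R - x) `^ (H - 1 / 2) * Lint (H - 1 / 2) n x))//.
- by congr (_ * (_ * _)); apply: eq_Rintegral => x _; rewrite mulrA.
- by lra.
- apply: measurable_funM; last exact: measurable_Lint.
  by apply: (measurableT_comp (measurable_powR _)); exact: measurable_funB.
- by move=> x; rewrite mulr_ge0 ?powR_ge0 ?Lint_ge0.
move=> x /andP[x1 x2]; rewrite kHE; congr (_ * _).
by rewrite -Fint_last//; [congr Fint; rewrite mulrC|lra].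
Qed.

Lemma powR_nat_large (p C : R) : 0 < p ->
  exists M, forall m, (M <= m)%N -> C <= m%:R `^ p.
Proof.
move=> p0; pose x := `|C| `^ p^-1.
exists (Num.bound x) => m Mm.
have xm : x <= m%:R.
  apply: (@le_trans _ _ (Num.bound x)%:R); last by rewrite ler_nat.
  by rewrite ltW// archi_boundP// powR_ge0.
apply: (le_trans (ler_norm C)).
have -> : `|C| = x `^ p by rewrite /x -powRrM mulVf ?gt_eqF// powRr1.
by apply: ler_ppowR => //; [exact: ltW|exact: powR_ge0].
Qed.

(** Both indices are shifted by one: row N holds the N weights of Y at time N + 1, and column i
    belongs to letter i of a word, that is to the sign numbered i + 1. *)
Definition coef (h : R) (N i : nat) : R := Jint h N.+1 i.+1.

Lemma coef_ge0 h N i : 0 <= coef h N i.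
Proof. exact: Jint_ge0. Qed.

Lemma coef_cvg0 (h : R) : 0 < h < 1 / 2 -> forall i (e : R), 0 < e ->
  exists N0, forall N, (N0 <= N)%N -> coef h N i <= e.
Proof.
move=> h01 i e e0; have p0 : 0 < 1 - 2 * h by lra.
have [M MP] := powR_nat_large (6 / e) p0.
exists (M + i + 2)%N => N NM; pose m := (N - i.+1)%N.
have m0 : (0 < m)%N by rewrite /m; lia.
have := Jint_le h01 (ltn0Sn i) m0.
rewrite /coef (_ : (i.+1 + m).+1 = N.+1); last by rewrite /m; lia.
move=> /le_trans; apply.
have mp : 0 < m%:R `^ (1 - 2 * h) by rewrite powR_gt0// ltr0n.
rewrite (_ : 2 * h - 1 = - (1 - 2 * h)); last by ring.
rewrite powRN ler_pdivrMr// mulrC -ler_pdivrMr//.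
by apply: MP; rewrite /m; lia.
Qed.

Lemma coef_dvg (h : R) : 0 < h < 1 / 2 -> forall C : R, exists K N0, forall N, (N0 <= N)%N ->
  C <= \sum_(i < K) coef h N (N - K + i)%N.
Proof.
move=> h01 C.
have ndh : nondecreasing_seq (series (@harmonic R)).
  by apply: nondecreasing_series => i _ _; exact: harmonic_ge0.
(* The comparison series starts at 1/3; the 2 covers the missing terms 1 and 1/2. *)
have /cvgryPge/(_ (C + 2)) [L _ LP] := nondecreasing_dvgn_lt ndh (@dvg_harmonic R).
(* The last of the L + 1 coefficients is next to the diagonal, outside the range of [Jint_ge]; only
   its sign is used. *)
exists L.+1, (L + 2)%N => N NL; rewrite big_ord_recr /=.
apply: (@le_trans _ _ (\sum_(i < L) (L - i).+2%:R^-1)); last first.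
  rewrite -[leLHS]addr0; apply: lerD; last exact: coef_ge0.
  apply: ler_sum => i _; rewrite /coef.
  have := @Jint_ge R h h01 (N - L.+1 + i).+1 (L - i) _ _.
  have iL := ltn_ord i.
  rewrite (_ : ((N - L.+1 + i).+1 + (L - i)).+1 = N.+1); last by lia.
  by apply; lia.
have -> : \sum_(i < L) (L - i).+2%:R^-1 = \sum_(i < L) @harmonic R (i + 2)%N.
  rewrite (reindex_inj rev_ord_inj); apply: eq_bigr => i _ /=.
  by rewrite /harmonic; congr (_%:R^-1); have := ltn_ord i; lia.
have E2 : \sum_(2 <= i < L + 2) @harmonic R i = \sum_(i < L) @harmonic R (i + 2)%N.
  by rewrite -[LHS]/(\sum_(0 + 2 <= i < L + 2) @harmonic R i) big_addn addnK big_mkord.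
have := LP (L + 2)%N (leq_addr 2 L); rewrite /series/= (@big_cat_nat _ _ _ 2)//=; last by rewrite addn2.
rewrite E2.
have : \sum_(0 <= i < 2) @harmonic R i <= 2.
  rewrite 2?big_nat_recr//= big_geq// add0r /harmonic.
  have : 2^-1 <= 1 :> R by lra.
  by rewrite invr1; lra.
by move=> ? ?; lra.
Qed.

(** Telescoping: with a and b the roots of two consecutive integers, [b^(-3) <= 2 / a - 2 / b],
    which follows from (b - a)(b + a) = 1. *)
Lemma sum_nat_powR32 M : \sum_(j < M) ((j.+1)%:R * Num.sqrt (j.+1)%:R)^-1 <= 3 :> R.
Proof.
suff H n : \sum_(j < n.+1) ((j.+1)%:R * Num.sqrt (j.+1)%:R)^-1 <=
    3 - 2 * (Num.sqrt n.+1%:R)^-1 :> R.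
  case: M => [|M]; first by rewrite big_ord0.
  apply: (le_trans (H M)); rewrite gerBl mulr_ge0// invr_ge0 sqrtr_ge0//.
elim: n => [|n IH]; first by rewrite big_ord1 sqrtr1 mulr1 invr1; lra.
rewrite big_ord_recr /=; apply: (le_trans (lerD IH (lexx _))).
set a := Num.sqrt n.+1%:R; set b := Num.sqrt n.+2%:R.
have a0 : 0 < a :> R by rewrite sqrtr_gt0 ltr0n.
have b0 : 0 < b :> R by rewrite sqrtr_gt0 ltr0n.
have a2 : a ^+ 2 = n.+1%:R :> R by rewrite sqr_sqrtr.
have b2 : b ^+ 2 = n.+2%:R :> R by rewrite sqr_sqrtr.
have ab : b ^+ 2 = a ^+ 2 + 1 by rewrite a2 b2 natr1.
rewrite -b2.
suff : (b ^+ 2 * b)^-1 <= 2 * a^-1 - 2 * b^-1 by lra.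
have -> : 2 * a^-1 - 2 * b^-1 = 2 * (b - a) / (a * b) by field; rewrite !gt_eqF.
have -> : (b ^+ 2 * b)^-1 = (b ^+ 2)^-1 * a / (a * b) by field; rewrite !gt_eqF.
rewrite ler_pM2r ?invr_gt0 ?mulr_gt0// mulrC ler_pdivrMr ?exprn_gt0//.
have lab : a < b by nra.
have : (b - a) * (b + a) = 1 by rewrite -subr_sqr ab; ring.
nra.
Qed.

(** For h <= 1/8 the squared bound [36 m^(4 h - 2)] is at most [36 m^(-3/2)]. The total is 252 =
    12^2 + 36 * 3, the square being that of the coefficient next to the diagonal. *)
Lemma sum_coef_sqr_le (h : R) : 0 < h <= 1 / 8 ->
  exists N0, forall N, (N0 <= N)%N -> \sum_(i < N) coef h N i ^+ 2 <= 252.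
Proof.
move=> h08; have h01 : 0 < h < 1 / 2 by lra.
exists 2%N => -[//|M] M1; rewrite big_ord_recr /=.
have D : coef h M.+1 M ^+ 2 <= 144.
  have := Jint_diag_le h01 (n := M.+2) ltac:(lia).
  have := coef_ge0 h M.+1 M; rewrite /coef /=; nra.
suff : \sum_(i < M) coef h M.+1 i ^+ 2 <= 36 * 3 by lra.
apply: (@le_trans _ _ (36 * \sum_(j < M) ((j.+1)%:R * Num.sqrt (j.+1)%:R)^-1)); last first.
  by rewrite ler_wpM2l// sum_nat_powR32.
rewrite mulr_sumr (reindex_inj rev_ord_inj) /=; apply: ler_sum => j _.
have jM := ltn_ord j.
have := Jint_le h01 (i := (M - j.+1).+1) (m := j.+1) isT isT.
rewrite (_ : ((M - j.+1).+1 + j.+1).+1 = M.+2); last by lia.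
rewrite -/(coef h M.+1 (M - j.+1)) => cj.
have j1 : 1 <= j.+1%:R :> R by rewrite ler1n.
have j0 : 0 < j.+1%:R :> R by rewrite ltr0n.
apply: (@le_trans _ _ ((6 * j.+1%:R `^ (2 * h - 1)) ^+ 2)).
  by rewrite lerXn2r ?nnegrE ?coef_ge0// mulr_ge0 ?powR_ge0.
rewrite exprMn (_ : 6 ^+ 2 = 36); last by ring.
rewrite ler_wpM2l// -powR_mulrn ?powR_ge0// -powRrM.
apply: (@le_trans _ _ (j.+1%:R `^ (- (1 + 2^-1)))); first by apply: ler_powR; lra.
rewrite powRN powRD; last by apply/implyP => _; rewrite gt_eqF.
by rewrite powRr1 ?powR12_sqrt// ltW.
Qed.

End coefficients.

(** * Paths exceeding the threshold *)

Section almost_sure.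
Context {R : realType} (d : measure_display) (T : measurableType d)
  (P : probability T R) (xi : nat -> {RV P >-> R}).

Lemma measurable_YH (sigma H : R) n : measurable_fun [set: T] (YH xi sigma H n).
Proof. by apply: measurable_sum => i; exact: measurable_funM. Qed.

Lemma measurable_gH_lt_YH (sigma H : R) n :
  measurable [set w | gH sigma H n < `|YH xi sigma H n w|].
Proof.
rewrite (_ : [set w | _] =
    (fun w => `|YH xi sigma H n w|) @^-1` `]gH sigma H n, +oo[%classic); last first.
  by apply/seteqP; split=> w /=; rewrite in_itv/= andbT.
rewrite -[X in measurable X]setTI.
have mn : measurable_fun [set: T] (fun w => `|YH xi sigma H n w|).
  by apply: measurableT_comp => //; exact: measurable_YH.
by apply: mn => //; exact: measurable_itv.
Qed.

Lemma measurable_tail_bigcap (A : nat -> set T) n0 : (forall n, measurable (A n)) ->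
  measurable (\bigcap_(k in [set k | (n0 <= k)%N]) A k).
Proof.
by move=> mA; apply: bigcap_measurable => //; exists n0; rewrite /=.
Qed.

Lemma prob_ult_eq0 (A : nat -> set T) : (forall n, measurable (A n)) ->
  (forall n0, P (\bigcap_(k in [set k | (n0 <= k)%N]) A k) = 0%E) ->
  P (ult A) = 0%E.
Proof.
move=> mA PA; apply/negligibleP.
  by apply: bigcup_measurable => n _; exact: measurable_tail_bigcap.
apply: (@negligibleS _ _ _ _ (\bigcup_n \bigcap_(k in [set k | (n <= k)%N]) A k)).
  by move=> w [n _ nw]; exists n.
apply: negligible_bigcup => n; apply/negligibleP; last exact: PA.
exact: measurable_tail_bigcap.
Qed.

Lemma prob_io_eq1 (A : nat -> set T) : (forall n, measurable (A n)) ->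
  (forall n0, P (\bigcap_(k in [set k | (n0 <= k)%N]) ~` A k) = 0%E) ->
  P (io A) = 1%E.
Proof.
move=> mA PA; have mC n : measurable (~` A n) by exact: measurableC.
have ioE : io A = ~` ult (fun k => ~` A k).
  rewrite /io /ult setC_bigcup; apply: eq_bigcapr => n _.
  by rewrite setC_bigcap; apply: eq_bigcupr => k _; rewrite setCK.
rewrite ioE probability_setC; last first.
  by apply: bigcup_measurable => n _; exact: measurable_tail_bigcap.
by rewrite [X in (_ - X)%E](_ : _ = 0%E) ?sube0//; exact: prob_ult_eq0.
Qed.

Lemma YH_cylinder (sigma H : R) n s w : (n <= size s)%N -> cylinder xi s w ->
  YH xi sigma H n.+1 w = sigma * C_H H * wsum (coef (H - 1 / 2) n) n s.
Proof.
move=> ns sw; rewrite /YH big_add1 /= big_mkord /wsum mulr_sumr.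
apply: eq_bigr => i _; rewrite jHE -mulrA sw// (leq_trans _ ns)//.
Qed.

End almost_sure.

Section conclusion.
Context {R : realType}.
Implicit Types (sigma H h : R).

(* The level exceeds by 1 the upper bound 2 / h of the threshold; the margin absorbs
   the drift in the arbitrage condition. *)
Definition large h m s : bool := 2 * h^-1 + 1 <= wsum (coef h m) m s.

(** For h < 1/100 the level 24 lies below the lower bound 1 / (4 h) > 25 of the threshold. *)
Definition small h m s : bool := `|wsum (coef h m) m s| <= 24.

Lemma large_catl h m p q : (m <= size p)%N -> large h m (p ++ q) = large h m p.
Proof. by move=> mp; rewrite /large wsum_catl. Qed.

Lemma small_catl h m p q : (m <= size p)%N -> small h m (p ++ q) = small h m p.
Proof. by move=> mp; rewrite /small wsum_catl. Qed.

Lemma frequently_large h : 0 < h < 1 / 2 ->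
  exists2 delta : R, 0 < delta & forall m, exists r, forall p,
    size p = m -> delta <= wavg r (fun q => (large h (m + r)%N (p ++ q))%:R).
Proof.
move=> h01.
by apply: wsum_frequently_large (coef_cvg0 h01) (coef_dvg h01) _ => N i _; exact: coef_ge0.
Qed.

Lemma frequently_small h : 0 < h < 1 / 100 -> forall m, exists r, forall p,
    size p = m -> (2^-1 : R) <= wavg r (fun q => (small h (m + r)%N (p ++ q))%:R).
Proof.
move=> h100; have h01 : 0 < h < 1 / 2 by lra.
have := @wsum_frequently_small R (coef h) (fun N i _ => coef_ge0 h N i) (coef_cvg0 h01) 252 23.
have -> : (23 + 1 : R) = 24 by ring.
apply; [by []|lra|].
by apply: sum_coef_sqr_le; lra.
Qed.

Lemma sigma_C_H_gt0 sigma H : 0 < sigma -> 1 / 2 < H < 1 -> 0 < sigma * C_H H.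
Proof. by move=> sigma0 H01; rewrite mulr_gt0 ?C_H_gt0. Qed.

Lemma prob_YH_io sigma H d (T : measurableType d) (P : probability T R)
    (xi : nat -> {RV P >-> R}) :
  0 < sigma -> 1 / 2 < H < 1 -> iid_rademacher xi ->
  P (io (fun n => [set w | gH sigma H n < `|YH xi sigma H n w|])) = 1%E.
Proof.
move=> sigma0 H01 xi_iid; have h01 : 0 < H - 1 / 2 < 1 / 2 by lra.
have kappa0 := sigma_C_H_gt0 sigma0 H01.
have [delta d0 dP] := frequently_large h01.
apply: prob_io_eq1 => [n|n0]; first exact: measurable_gH_lt_YH.
(* Words of length n speak of time n + 1; starting at n0 + 1 guarantees n + 1 > 1, as the bounds on
   [Gint] require. *)
apply: (@prob_never_eq0 R _ T P xi xi_iid (large (H - 1 / 2)) delta _ n0.+1) => //.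
- exact: large_catl.
- by apply: measurable_tail_bigcap => n; apply: measurableC; exact: measurable_gH_lt_YH.
move=> w s n Ew ws /andP[n0n ns]; apply/negP => nl.
have /= := Ew n.+1 (leqW (ltnW n0n)); apply.
rewrite (YH_cylinder _ _ ns ws) gHE normrM gtr0_norm// ltr_pM2l//.
apply: (lt_le_trans _ (ler_norm _)); apply: lt_le_trans nl.
have n1 : (1 < n.+1)%N by rewrite ltnS (leq_ltn_trans (leq0n n0)).
by rewrite (le_lt_trans (Gint_le h01 n1))// ltrDl.
Qed.

Lemma prob_YH_ult sigma H d (T : measurableType d) (P : probability T R)
    (xi : nat -> {RV P >-> R}) :
  0 < sigma -> 1 / 2 < H < 1 / 2 + 1 / 100 -> iid_rademacher xi ->
  P (ult (fun n => [set w | gH sigma H n < `|YH xi sigma H n w|])) = 0%E.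
Proof.
move=> sigma0 H100 xi_iid; have H01 : 1 / 2 < H < 1 by lra.
have h01 : 0 < H - 1 / 2 < 1 / 2 by lra.
have h100 : 0 < H - 1 / 2 < 1 / 100 by lra.
have kappa0 := sigma_C_H_gt0 sigma0 H01.
apply: prob_ult_eq0 => [n|n0]; first exact: measurable_gH_lt_YH.
apply: (@prob_never_eq0 R _ T P xi xi_iid (small (H - 1 / 2)) 2^-1 _ n0.+1) => //.
- exact: small_catl.
- exact: frequently_small.
- by apply: measurable_tail_bigcap => n; exact: measurable_gH_lt_YH.
move=> w s n Ew ws /andP[n0n ns]; apply/negP => nsm.
have /= := Ew n.+1 (leqW (ltnW n0n)).
rewrite (YH_cylinder _ _ ns ws) gHE normrM gtr0_norm// ltr_pM2l// => /lt_le_trans/(_ nsm).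
have n1 : (1 < n.+1)%N by rewrite ltnS (leq_ltn_trans (leq0n n0)).
apply/negP; rewrite -leNgt; apply: (le_trans _ (Gint_ge h01 n1)).
by rewrite -[leLHS]invrK lef_pV2 ?posrE ?invr_gt0//; lra.
Qed.

Lemma YN_codom sigma H (N n : nat) (x : {ffun 'I_(N.-1) -> bool}) :
  1 / 2 < H < 1 -> (n < N)%N ->
  YN R sigma H N n.+1 x =
  N%:R `^ (- H) * (sigma * C_H H * wsum (coef (H - 1 / 2) n) n (codom x)).
Proof.
move=> H01 nN; rewrite /YN /wsum !mulr_sumr.
rewrite (big_ord_widen_cond N.-1 xpredT (fun i => N%:R `^ (- H) * (sigma * C_H H *
  (coef (H - 1 / 2) n i * sgnb R (nth false (codom x) i))))); last by lia.
apply: eq_big => [i|i]; first by rewrite ltnS.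
rewrite ltnS => iN.
rewrite JNE//; [|by lia..]; rewrite jHE -!mulrA; do 4 congr (_ * _).
have := nth_codom false x (enum_rank i); rewrite enum_rankK enum_rank_ord /= => ->.
by [].
Qed.

(** The margin 1 in [large] becomes [N^(-H) * sigma * C_H H] after scaling, and this dominates the
    drift [|c| / N] once [N^(1 - H)] is large, because H < 1. *)
Lemma in_A_large sigma H (a : R -> R) (c : R) (N n : nat) (x : {ffun 'I_(N.-1) -> bool}) :
  0 < sigma -> 1 / 2 < H < 1 ->
  (forall t, t \in `[0, 1] -> c <= a t) ->
  `|c| / (sigma * C_H H) <= N%:R `^ (1 - H) ->
  (0 < n < N)%N -> large (H - 1 / 2) n (codom x) ->
  in_A R a sigma H N n.+1 x.
Proof.
move=> sigma0 H01 ca cN /andP[n0 nN] nl; have h01 : 0 < H - 1 / 2 < 1 / 2 by lra.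
have kappa0 := sigma_C_H_gt0 sigma0 H01.
have posN : (0 < N)%N := leq_ltn_trans (leq0n n) nN.
have N0 : 0 < N%:R :> R by rewrite ltr0n.
have nN1 : n.+1%:R / N%:R <= 1 :> R by rewrite ler_pdivrMr// mul1r ler_nat.
apply/orP; right; rewrite /dN YN_codom ?gNE// gHE -mulrBr -mulrBr /aN.
apply: (@le_trans _ _ (N%:R^-1 * `|c|)).
  rewrite -mulrN ler_pM2l ?invr_gt0//; apply: (@le_trans _ _ (- c)).
    by rewrite lerN2 ca// in_itv/= divr_ge0.
  by rewrite -normrN ler_norm.
apply: (@le_trans _ _ (N%:R `^ (- H) * (sigma * C_H H))).
  move: cN; rewrite ler_pdivrMr// powRD; last by apply/implyP => _; rewrite gt_eqF.
  rewrite powRr1 ?(ltW N0)// => cN.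
  rewrite [leLHS]mulrC ler_pdivrMr//; apply: (le_trans cN).
  by rewrite le_eqVlt; apply/orP; left; apply/eqP; ring.
rewrite ler_wpM2l ?powR_ge0// ler_pMr//.
have := Gint_le h01 (n := n.+1) n0; move: nl; rewrite /large => ? ?; lra.
Qed.

Lemma arb_paths_cvg1 sigma H (a : R -> R) :
  0 < sigma -> 1 / 2 < H < 1 -> {within `[0, 1], continuous a} ->
  (fun N : nat => (#|@arb_paths R a sigma H N|%:R / 2 ^+ N.-1 : R)) @ \oo --> (1 : R).
Proof.
move=> sigma0 H01 ca; have [c _ cP] := EVT_min ler01 ca.
have h01 : 0 < H - 1 / 2 < 1 / 2 by lra.
have [delta d0 dP] := frequently_large h01.
have H1 : 0 < 1 - H by lra.
have [M MP] := powR_nat_large (`|a c| / (sigma * C_H H)) H1.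
apply/cvgrPdist_le => e e0.
(* m depends on e only, so longer paths merely append signs to the first m. The range starts at 1
   because [in_A_large] concerns times n + 1 with n > 0. *)
have [m mP] := wavg_none_small (@large_catl (H - 1 / 2)) d0 dP 1 e0.
exists (m + M + 2)%N => // N /= NM.
have mN : (m <= N.-1)%N by lia.
have MN : (M <= N)%N by lia.
have sub : ~: @arb_paths R a sigma H N \subset
    [pred x : {ffun 'I_N.-1 -> bool} | all (fun n => ~~ large (H - 1 / 2) n (codom x)) (index_iota 1 m)].
  apply/fintype.subsetP => x; rewrite !inE => /existsPn xP.
  apply/allP => n; rewrite mem_index_iota => /andP[n0 nm]; apply/negP => nl.
  have nN : (n < N)%N by lia.
  have /negP := xP (Ordinal (nN : (n.+1 < N.+1)%N)); apply; rewrite /=.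
  by apply: in_A_large sigma0 H01 cP (MP N MN) _ nl; rewrite n0.
have p2 : 0 < 2 ^+ N.-1 :> R by rewrite exprn_gt0.
have cardE : 1 - #|@arb_paths R a sigma H N|%:R / 2 ^+ N.-1 =
    #|~: @arb_paths R a sigma H N|%:R / 2 ^+ N.-1 :> R.
  apply/eqP; rewrite subr_eq -mulrDl -natrD addnC cardsC.
  rewrite card_ffun card_bool card_ord natrX.
  by rewrite divff// gt_eqF.
rewrite cardE ger0_norm; last by rewrite divr_ge0 ?exprn_ge0.
apply: le_trans (mP _ mN); rewrite wavg_card ler_pM2r ?invr_gt0// ler_nat.
exact: subset_leq_card.
Qed.

End conclusion.

Theorem theorem3p5 (R : realType) (sigma : R) (a : R -> R) :
  0 < sigma -> {within `[0, 1], continuous a} ->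
  exists Hc : R, 1/2 < Hc < 1 /\
    (forall H : R, Hc < H < 1 ->
       forall (d : measure_display) (T : measurableType d) (P : probability T R)
              (xi : nat -> {RV P >-> R}),
       iid_rademacher xi ->
       P (io (fun n => [set w | gH sigma H n < `|YH xi sigma H n w|])) = 1%E) /\
    (forall H : R, 1/2 < H < Hc ->
       forall (d : measure_display) (T : measurableType d) (P : probability T R)
              (xi : nat -> {RV P >-> R}),
       iid_rademacher xi ->
       P (ult (fun n => [set w | gH sigma H n < `|YH xi sigma H n w|])) = 0%E) /\
    (forall H : R, Hc < H < 1 ->
       (fun N : nat => (#|@arb_paths R a sigma H N|%:R / 2 ^+ N.-1 : R)) @ \oo --> (1 : R)).
Proof.
move=> sigma0 ca; exists (1 / 2 + 1 / 100); split; first by lra.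
split; [|split].
- by move=> H H01 d T P xi; apply: prob_YH_io => //; lra.
- by move=> H H01 d T P xi; apply: prob_YH_ult => //; lra.
- by move=> H H01; apply: arb_paths_cvg1 => //; lra.
Qed.
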